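(* Let $W$ be a graphon, let $d,p\ge 1$, let $F=(F_1,\dots,F_d)$ be simple finite graphs with $V(F_m)=[p]$ for all $m$, let $\ell\in\mathcal{M}_p$ with $k=|\ell|$, and assume the Compatibility Condition holds. Then, almost surely, the sequence of random probability measures $(\Gamma_n^{F,\ell})_{n\ge p}$ on $[0,1]^d$ converges weakly to the deterministic probability measure $\Gamma^{F,\ell}$.
   Context: A graphon is a symmetric measurable function $W:[0,1]^2\to[0,1]$. Let $X=(X_i)_{i\ge1}$ be i.i.d. uniform on $[0,1]$. For each $n$, $G_n=G_n(W)$ is the random simple graph on vertex set $[n]=\{1,\dots,n\}$ in which, conditionally on $X$, each pair $\{i,j\}$, $i\ne j$, is an edge independently with probability $W(X_i,X_j)$ (all $G_n$ built from the same sequence $X$ and, conditionally on $X$, independent edge indicators). For $n\ge k$, $\mathcal{S}_{n,k}$ is the set of words $\beta=\beta_1\cdots\beta_k$ with distinct characters in $[n]$; $\mathcal{M}_p=\bigcup_{k\in[p]}\mathcal{S}_{p,k}$; $|\beta|$ is the length. For $\ell\in\mathcal{S}_{p,k}$, $\alpha\in\mathcal{S}_{n,k}$ ($n\ge p$), let $\mathcal{S}^{\ell,\alpha}_{n,p}=\{\beta\in\mathcal{S}_{n,p}:\beta_{\ell_i}=\alpha_i\ \forall i\in[k]\}$. For a simple graph $F$ on $[p]$ and a graph $G$ on $[n]$, $t_{\rm inj}(F^\ell,G^\alpha)=|\mathcal{S}^{\ell,\alpha}_{n,p}|^{-1}\#\{\beta\in\mathcal{S}^{\ell,\alpha}_{n,p}: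 \{\beta_i,\beta_j\}\in E(G)\ \forall \{i,j\}\in E(F)\}$, and for $F=(F_1,\dots,F_d)$, $t_{\rm inj}(F^\ell,G^\alpha)=(t_{\rm inj}(F_m^\ell,G^\alpha))_{m\in[d]}\in[0,1]^d$. Compatibility Condition: for all $m,m'\in[d]$ and all $i,i'\in\{\ell_1,\dots,\ell_k\}$, $\{i,i'\}\in E(F_m)\iff\{i,i'\}\in E(F_{m'})$; let $E^{[\ell]}$ be this common set of edges with both endpoints among the labels. For $x\in[0,1]^k$: $\hat t_x=\prod_{\{\ell_i,\ell_j\}\in E^{[\ell]}}W(x_i,x_j)$; $\tilde t_x(F_m^\ell,W)=\int \prod_{\{i,j\}\in E(F_m)\setminus E^{[\ell]}}W(y_i,y_j)\prod_{q\in[p]\setminus\{\ell_1,\dots,\ell_k\}}dy_q$ where $y_{\ell_i}=x_i$ for $i\in[k]$ and the other coordinates are integrated over $[0,1]$; $\tilde t_x=(\tilde t_x(F_m^\ell,W))_{m\in[d]}$; $\hat t=\int_{[0,1]^k}\hat t_x\,dx$. For measurable nonnegative $g$ on $[0,1]^d$: $\Gamma_n^{F,\ell}(g)=|\mathcal{S}_{n,k}|^{-1}\sum_{\alpha\in\mathcal{S}_{n,k}}g(t_{\rm inj}(F^\ell,G_n^\alpha))$ and $\Gamma^{F,\ell}(g)=\int_{[0,1]^k}\hat t_x\,g(\tilde t_x)\,dx+(1-\hat t)\,g(0)$. *)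

(* Defs.v *)
From HB Require Import structures.
From mathcomp Require Import all_boot all_order all_algebra.
From mathcomp Require Import all_classical all_reals all_analysis.
Set Implicit Arguments. Unset Strict Implicit. Unset Printing Implicit Defensive.
Import Order.TTheory GRing.Theory Num.Theory.
Import numFieldNormedType.Exports.
Local Open Scope classical_set_scope.
Local Open Scope ring_scope.

Section Defs.
Variable R : realType.

(* W : [0,1]^2 -> [0,1] is represented by a function R -> R -> R that is
   Borel measurable on R*R, symmetric and [0,1]-valued. *)
Definition graphon (W : R -> R -> R) : Prop :=
  [/\ measurable_fun setT (fun z : R * R => W z.1 z.2),
      (forall x y, W x y = W y x) & (forall x y, 0 <= W x y <= 1)].

Definition iid_uniform d (Omega : measurableType d) (P : probability Omega R)
  (X : nat -> Omega -> R) : Prop :=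
  (forall i, measurable_fun setT (X i)) /\
  forall (N : nat) (B : 'I_N -> set R), (forall i, measurable (B i)) ->
    (\int[P]_w (\prod_(i < N) \1_(B i) (X i w))%:E =
     (\prod_(i < N) fine (lebesgue_measure (B i `&` `[0%R, 1%R])))%:E)%E.

(* Conditionally on X, the edge indicators xi i j (i < j) are independent
   with P(xi i j = true | X) = W (X i) (X j).  Stated through its defining
   identity: for every cylinder event {X_i \in B_i, i < N} and every finite
   set S of pairs i<j, E[1_{X in B} prod_S 1_{xi = e}] = E[1_{X in B} prod_S w_e]. *)
Definition edge_law d (Omega : measurableType d) (P : probability Omega R)
  (W : R -> R -> R) (X : nat -> Omega -> R) (xi : nat -> nat -> Omega -> bool)
  : Prop :=
  [/\ (forall i j, measurable [set w | xi i j w]),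
      (forall i j w, xi i j w = xi j i w) &
  forall (N : nat) (B : 'I_N -> set R) (S : {set 'I_N * 'I_N})
         (e : 'I_N -> 'I_N -> bool),
    (forall i, measurable (B i)) ->
    (forall q, q \in S -> (q.1 < q.2)%N) ->
    (\int[P]_w ((\prod_(i < N) \1_(B i) (X i w)) *
                \prod_(q in S) ((xi q.1 q.2 w == e q.1 q.2)%:R))%:E =
     \int[P]_w ((\prod_(i < N) \1_(B i) (X i w)) *
                \prod_(q in S) (if e q.1 q.2 then W (X q.1 w) (X q.2 w)
                                else 1 - W (X q.1 w) (X q.2 w)))%:E)%E].

(* vertices are 0-based: [n] is 'I_n; words of distinct characters in [n]
   of length k are injective maps 'I_k -> 'I_n. *)
Definition words (k n : nat) : {set {ffun 'I_k -> 'I_n}} :=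
  [set a : {ffun 'I_k -> 'I_n} | injectiveb a].

Definition ext_words (p k n : nat) (l : 'I_k -> 'I_p) (a : 'I_k -> 'I_n)
  : {set {ffun 'I_p -> 'I_n}} :=
  [set b : {ffun 'I_p -> 'I_n} | injectiveb b && [forall i, b (l i) == a i]].

Definition tinj (p k n : nat) (F : rel 'I_p) (l : 'I_k -> 'I_p)
  (G : rel nat) (a : 'I_k -> 'I_n) : R :=
  (#|ext_words l a|%:R)^-1 *
  #|[set b in ext_words l a |
      [forall i : 'I_p, forall j : 'I_p, F i j ==> G (b i) (b j)]]|%:R.

Definition tinjv (d p k n : nat) (F : 'I_d -> rel 'I_p) (l : 'I_k -> 'I_p)
  (G : rel nat) (a : 'I_k -> 'I_n) : 'rV[R]_d :=
  \row_m tinj (F m) l G a.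

Definition Gamma_n (d p k n : nat) (F : 'I_d -> rel 'I_p) (l : 'I_k -> 'I_p)
  (G : rel nat) (g : 'rV[R]_d -> R) : R :=
  (#|words k n|%:R)^-1 * \sum_(a in words k n) g (tinjv F l G a).

Definition upd (I : eqType) (y : I -> R) (i : I) (t : R) : I -> R :=
  fun j => if j == i then t else y j.

Fixpoint cint (I : eqType) (s : seq I) (f : (I -> R) -> R) (y : I -> R) : R :=
  match s with
  | [::] => f y
  | i :: s' => Rintegral (@lebesgue_measure R) `[0%R, 1%R]
                 (fun t => cint s' f (upd y i t))
  end.

Definition cube_int (k : nat) (f : ('I_k -> R) -> R) : R :=
  cint (enum 'I_k) f (fun _ => 0).

(* y with y_{l_i} = x_i (other coordinates: placeholder 0, always integrated) *)
Definition lab (p k : nat) (l : 'I_k -> 'I_p) (x : 'I_k -> R) : 'I_p -> R :=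
  fun q => if [pick i | l i == q] is Some i then x i else 0.

Definition labelled (p k : nat) (l : 'I_k -> 'I_p) (q : 'I_p) : bool :=
  [exists i, l i == q].

Definition Elab (d p k : nat) (F : 'I_d -> rel 'I_p) (l : 'I_k -> 'I_p)
  (i j : 'I_p) : bool :=
  [&& (i < j)%N, labelled l i, labelled l j & [forall m, F m i j]].

Definition that_x (d p k : nat) (W : R -> R -> R) (F : 'I_d -> rel 'I_p)
  (l : 'I_k -> 'I_p) (x : 'I_k -> R) : R :=
  \prod_(i : 'I_p) \prod_(j : 'I_p | Elab F l i j) W (lab l x i) (lab l x j).

Definition ttilde_x (d p k : nat) (W : R -> R -> R) (F : 'I_d -> rel 'I_p)
  (l : 'I_k -> 'I_p) (x : 'I_k -> R) (m : 'I_d) : R :=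
  cint [seq q <- enum 'I_p | ~~ labelled l q]
    (fun y => \prod_(i : 'I_p) \prod_(j : 'I_p | [&& (i < j)%N, F m i j
                                                  & ~~ Elab F l i j])
                 W (y i) (y j))
    (lab l x).

Definition ttilde_v (d p k : nat) (W : R -> R -> R) (F : 'I_d -> rel 'I_p)
  (l : 'I_k -> 'I_p) (x : 'I_k -> R) : 'rV[R]_d :=
  \row_m ttilde_x W F l x m.

Definition that (d p k : nat) (W : R -> R -> R) (F : 'I_d -> rel 'I_p)
  (l : 'I_k -> 'I_p) : R := cube_int (that_x W F l).

Definition Gamma (d p k : nat) (W : R -> R -> R) (F : 'I_d -> rel 'I_p)
  (l : 'I_k -> 'I_p) (g : 'rV[R]_d -> R) : R :=
  cube_int (fun x => that_x W F l x * g (ttilde_v W F l x))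
  + (1 - that W F l) * g 0.

Definition cube (d : nat) : set 'rV[R]_d := [set v | forall i, 0 <= v ord0 i <= 1].

End Defs.

Definition simple_graph (p : nat) (F : rel 'I_p) : Prop :=
  symmetric F /\ irreflexive F.

Definition compatible (d p k : nat) (F : 'I_d -> rel 'I_p) (l : 'I_k -> 'I_p)
  : Prop :=
  forall (m m' : 'I_d) (i i' : 'I_p), labelled l i -> labelled l i' ->
    F m i i' = F m' i i'.

(* Main.v *)
Require Import Defs.
From HB Require Import structures.
From mathcomp Require Import all_boot all_order all_algebra.
From mathcomp Require Import all_classical all_reals all_analysis.
From mathcomp Require Import measurable_realfun ring lra.
Import Order.TTheory GRing.Theory Num.Theory.
Import numFieldNormedType.Exports.
Local Open Scope classical_set_scope.
Local Open Scope ring_scope.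

(** Method of moments.  A monomial of the vector t_inj(F^l, G_n^alpha), averaged
    over alpha, is up to O(1/n) the homomorphism density in G_n of the graph
    obtained by gluing the corresponding copies of F_1, ..., F_d along the
    labels; by compatibility the labelled edges are common to all copies.  The
    density of a fixed graph with v vertices has variance at most (2v)^2/n around
    the density of the graph in W, since two vertex-disjoint copies are
    independent.  Hence it converges almost surely along n = j^2, and along all n
    because n^v times the density is nondecreasing in n.  The countably many
    moments therefore converge almost surely to those of the limit (when at least
    one factor is present the mass 1 - that sits at 0 and does not contribute),
    and Bernstein's polynomials pass from moments to continuous functions on the
    compact cube. *)

Set Implicit Arguments.
Unset Strict Implicit.
Unset Printing Implicit Defensive.

(** * Expectations of bounded measurable functions *)

(** The statement integrates one coordinate at a time, whereas the sample is known only through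
    probabilities of boxes. The bridge is resampling: redrawing one coordinate of the sample
    uniformly leaves every expectation unchanged, because the two laws agree on boxes. Repeating
    this turns expectations into the iterated integrals of the statement. Injectivity spoils exact
    identities on the finite side: words have distinct letters, while products of averages range
    over all maps. Each passage between the two costs at most the proportion of noninjective maps,
    which a union bound over pairs of v vertices puts at v^2/n. This is also the origin of (2v)^2: a
    squared deviation is an average over maps from two disjoint copies of the vertex set, where
    injective maps contribute nothing in expectation and the others at most 1. A bound of order 1/n
    is not summable over n but is so over squares, whence the detour. Probability enters only for
    countably many monomials; the rest is deterministic for a fixed outcome, so the null set does
    not depend on the test function. *)

Section bounded_measurable.
Context d (S : measurableType d) (R : realType).
Implicit Types f g : S -> R.

(** Under a probability measure boundedness makes integrability automatic, so closure of this class
    under the operations used replaces all integrability side conditions. *)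
Definition bmeas f := measurable_fun setT f /\ exists M, forall x, `|f x| <= M.

Lemma eq_bmeas f g : (forall x, f x = g x) -> bmeas g -> bmeas f.
Proof. by move=> fg; have -> : f = g by apply/funext. Qed.

Lemma bmeas_cst c : bmeas (cst c).
Proof. by split; [exact: measurable_cst|exists `|c|]. Qed.

Lemma bmeasD f g : bmeas f -> bmeas g -> bmeas (fun x => f x + g x).
Proof.
move=> [mf [M hM]] [mg [N hN]]; split; first exact: measurable_funD.
by exists (M + N) => x; rewrite (le_trans (ler_normD _ _))// lerD.
Qed.

Lemma bmeasM f g : bmeas f -> bmeas g -> bmeas (fun x => f x * g x).
Proof.
move=> [mf [M hM]] [mg [N hN]]; split; first exact: measurable_funM.
by exists (M * N) => x; rewrite normrM ler_pM.
Qed.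

Lemma bmeasZ c f : bmeas f -> bmeas (fun x => c * f x).
Proof. by move=> bf; apply: bmeasM => //; exact: bmeas_cst. Qed.

Lemma bmeasB f g : bmeas f -> bmeas g -> bmeas (fun x => f x - g x).
Proof.
move=> bf bg.
apply: (@eq_bmeas _ (fun x => f x + -1 * g x)) => [x|]; first by rewrite mulN1r.
by apply: bmeasD => //; exact: bmeasZ.
Qed.

Lemma bmeas_sum (I : Type) (s : seq I) (p : pred I) (h : I -> S -> R) :
  (forall i, p i -> bmeas (h i)) -> bmeas (fun x => \sum_(i <- s | p i) h i x).
Proof.
move=> bh; elim: s => [|i s IH].
  by apply: (@eq_bmeas _ (cst 0)) => [x|]; [rewrite big_nil|exact: bmeas_cst].
case: (boolP (p i)) => pi.
  apply: (eq_bmeas _ (bmeasD (bh i pi) IH)) => x.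
  by rewrite big_cons pi.
by apply: (eq_bmeas _ IH) => x; rewrite big_cons (negbTE pi).
Qed.

Lemma bmeas_prod (I : Type) (s : seq I) (p : pred I) (h : I -> S -> R) :
  (forall i, p i -> bmeas (h i)) -> bmeas (fun x => \prod_(i <- s | p i) h i x).
Proof.
move=> bh; elim: s => [|i s IH].
  by apply: (@eq_bmeas _ (cst 1)) => [x|]; [rewrite big_nil|exact: bmeas_cst].
case: (boolP (p i)) => pi.
  apply: (eq_bmeas _ (bmeasM (bh i pi) IH)) => x.
  by rewrite big_cons pi.
by apply: (eq_bmeas _ IH) => x; rewrite big_cons (negbTE pi).
Qed.

Lemma bmeas_indic (A : set S) : measurable A -> bmeas \1_A.
Proof.
move=> mA; split; first exact: measurable_indic.
by exists 1 => x; rewrite indicE; case: (_ \in _); rewrite ?normr1 ?normr0.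
Qed.

Lemma bmeas_integrable (mu : {measure set S -> \bar R}) (D : set S) f :
  measurable D -> (mu D < +oo)%E -> bmeas f -> mu.-integrable D (EFin \o f).
Proof.
move=> mD muD [mf [M hM]]; apply: measurable_bounded_integrable => //.
  exact: measurable_funTS.
exists M; split; first exact: num_real.
by move=> N MN x _ /=; exact: le_trans (hM x) (ltW MN).
Qed.

End bounded_measurable.

Lemma bmeas_comp d d' (S : measurableType d) (S' : measurableType d') (R : realType)
    (h : S' -> S) (f : S -> R) :
  measurable_fun setT h -> bmeas f -> bmeas (fun x => f (h x)).
Proof.
by move=> mh [mf [M hM]]; split; [exact: measurableT_comp|exists M].
Qed.

Section bounded_expectation.
Context d (S : measurableType d) (R : realType) (P : probability S R).
Implicit Types f g : S -> R.

Lemma bmeas_integrableT f : bmeas f -> P.-integrable setT (EFin \o f).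
Proof.
move=> bf; apply: (bmeas_integrable measurableT _ bf).
by rewrite [X in (X < _)%E]probability_setT ltry.
Qed.

Lemma expectation_cst c : \int[P]_x (cst c x) = c :> R.
Proof. by rewrite Rintegral_cst// [X in fine X]probability_setT mulr1. Qed.

Lemma expectationD f g : bmeas f -> bmeas g ->
  \int[P]_x (f x + g x) = \int[P]_x f x + \int[P]_x g x.
Proof. by move=> bf bg; rewrite RintegralD//; exact: bmeas_integrableT. Qed.

Lemma expectationZ c f : bmeas f -> \int[P]_x (c * f x) = c * \int[P]_x f x.
Proof. by move=> bf; rewrite RintegralZl//; exact: bmeas_integrableT. Qed.

Lemma expectation_sum (I : Type) (s : seq I) (p : pred I) (h : I -> S -> R) :
  (forall i, p i -> bmeas (h i)) ->
  \int[P]_x (\sum_(i <- s | p i) h i x) = \sum_(i <- s | p i) \int[P]_x h i x.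
Proof.
move=> bh; elim: s => [|i s IH].
  under eq_Rintegral do rewrite big_nil.
  by rewrite big_nil; exact: expectation_cst.
under eq_Rintegral do rewrite big_cons.
rewrite big_cons; case: ifP => pi; last by rewrite IH.
by rewrite expectationD ?IH//; [exact: bh|exact: bmeas_sum].
Qed.

Lemma le_expectation f g : bmeas f -> bmeas g -> (forall x, f x <= g x) ->
  \int[P]_x f x <= \int[P]_x g x.
Proof.
by move=> bf bg fg; apply: le_Rintegral => //; exact: bmeas_integrableT.
Qed.

Lemma expectation_bound f M : bmeas f -> (forall x, `|f x| <= M) ->
  `|\int[P]_x f x| <= M.
Proof.
move=> bf fM; rewrite -[leRHS](expectation_cst) ler_norml -mulN1r.
rewrite -expectationZ; last exact: bmeas_cst.
apply/andP; split; apply: le_expectation => //; try exact: bmeas_cst.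
- by apply: bmeasZ; exact: bmeas_cst.
- by move=> x; rewrite mulN1r; have := fM x; rewrite ler_norml => /andP[].
- by move=> x; have := fM x; rewrite ler_norml => /andP[].
Qed.

End bounded_expectation.

Section bounded_fubini.
Context d1 d2 (S1 : measurableType d1) (S2 : measurableType d2) (R : realType).
Variables (P : probability S1 R).

Lemma bmeas_pair1 (phi : S1 * S2 -> R) y : bmeas phi -> bmeas (fun x => phi (x, y)).
Proof. by apply: bmeas_comp; exact: measurable_pair2. Qed.

Lemma bmeas_expectation (phi : S1 * S2 -> R) : bmeas phi ->
  bmeas (fun y => \int[P]_x phi (x, y)).
Proof.
move=> bphi; split.
  (* The measure on the second factor is only a pretext: boundedness gives integrability against any
     product of probabilities, so a Dirac mass will do. *)
  have := @measurable_fubini_G _ _ _ _ _ P (dirac point) _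
    (bmeas_integrableT (P \x dirac point)%E bphi).
  move=> mG; exact: (measurableT_comp (fine_measurable measurableT) mG).
have [M hM] := proj2 bphi.
by exists M => y; apply: expectation_bound => //; exact: bmeas_pair1.
Qed.

Lemma expectation_fubini (Q : probability S2 R) (phi : S1 * S2 -> R) : bmeas phi ->
  \int[(P \x Q)%E]_z phi z = \int[Q]_y (\int[P]_x phi (x, y)).
Proof.
move=> bphi; rewrite /Rintegral -integral21_prod_meas1; last first.
  exact: bmeas_integrableT.
congr fine; apply: eq_integral => y _.
rewrite /fubini_G /= fineK//.
have := integrable_fin_num measurableT (bmeas_integrableT P (bmeas_pair1 y bphi)).
exact.
Qed.

End bounded_fubini.

(** * Iterated integrals over the cube *)

Section boxes.
Variable R : realType.

Definition boxes (I : Type) : set (set (I -> R)) :=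
  [set [set y | forall i, B i (y i)] | B in [set B | forall i, measurable (B i)]].

(** The generating boxes are stable under intersection and include the whole space, so two
    probabilities that agree on boxes coincide, and box probabilities are what [iid_uniform]
    prescribes. For finite [I] this is the usual product sigma-algebra. *)
Definition coords (I : Type) := g_sigma_algebraType (@boxes I).

Lemma boxes_setI (I : Type) : setI_closed (@boxes I).
Proof.
move=> _ _ [B mB <-] [C mC <-]; exists (fun i => B i `&` C i).
  by move=> i; exact: measurableI.
by apply/seteqP; split => y /=; [move=> BC; split => i; case: (BC i)|move=> [? ?] i].
Qed.

Lemma boxes_setT (I : Type) : boxes [set: I -> R].
Proof.
by exists (fun=> setT) => [i|]; [exact: measurableT|apply/seteqP; split].
Qed.

Lemma measurable_coord (I : eqType) (i : I) :
  measurable_fun setT (fun y : coords I => y i).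
Proof.
move=> _ B mB; rewrite setTI; apply: sub_sigma_algebra.
exists (fun j => if j == i then B else setT) => [j /=|].
  by case: ifP => _ //; exact: measurableT.
apply/seteqP; split => y /= => [/(_ i)|By j]; first by rewrite eqxx.
by case: eqP => [->|].
Qed.

Lemma measurable_coords d (S : measurableType d) (I : finType) (h : S -> coords I) :
  (forall i, measurable_fun setT (fun x => h x i)) -> measurable_fun setT h.
Proof.
move=> mh; apply: (@measurability _ _ S (coords I) setT h (@boxes I)) => //.
move=> _ [_ [B mB <-] <-].
rewrite (_ : _ `&` _ = \big[setI/setT]_(i : I) ((fun x => h x i) @^-1` B i)).
  apply: bigsetI_measurable => i _.
  by rewrite -[X in measurable X]setTI; exact: mh.
rewrite setTI; apply/seteqP; split => x /=.
  by move=> Bx; elim/big_ind: _ => [//|? ? ? ?|i _]; [split|exact: Bx].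
by move=> Bx i; move: Bx; rewrite (bigD1 i)//= => -[].
Qed.

Lemma measurable_reindex (I J : finType) (h : J -> I) :
  measurable_fun setT (fun y : coords I => (fun j => y (h j)) : coords J).
Proof. by apply: measurable_coords => j; exact: measurable_coord. Qed.

Lemma measurable_upd (I : finType) (i : I) :
  measurable_fun setT (fun z : measurableTypeR R * coords I => upd z.2 i z.1 : coords I).
Proof.
apply: measurable_coords => j; rewrite /upd; case: (j == i).
  exact: measurable_fst.
by apply: (measurableT_comp (measurable_coord j)); exact: measurable_snd.
Qed.

End boxes.

Definition unif01 (R : realType) : probability (measurableTypeR R) R :=
  uniform_prob (@ltr01 R).
Notation cmeas f := (@bmeas _ (coords _ _) _ f).

Section unit_interval.
Variable R : realType.
Implicit Types f g : R -> R.

Lemma uniform01E (B : set R) : measurable B ->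
  unif01 R B = lebesgue_measure (B `&` `[0%R, 1%R]).
Proof.
move=> mB.
have := @integral_uniform R 0 1 ltr01 (EFin \o \1_B) _ _.
rewrite integral_indic// setIT => ->; last 2 first.
- by apply/measurable_EFinP; exact: measurable_indic.
- by move=> x; rewrite lee_fin.
by rewrite subr0 invr1 mul1e integral_indic.
Qed.

Lemma Rintegral01E f : bmeas f ->
  Rintegral (@lebesgue_measure R) `[0%R, 1%R] f = \int[unif01 R]_x f x.
Proof.
move=> bf; have [M fM] := bf.2.
(* The formula for integrals against the uniform law is applied to a nonnegative function: [f] is
   shifted by its bound, and the constant is cancelled at the end. *)
have f0 x : 0 <= f x + M.
  by rewrite -lerBlDr sub0r; have := fM x; rewrite ler_norml => /andP[].
have bfM : bmeas (fun x => f x + M) by apply: bmeasD => //; exact: bmeas_cst.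
have leb1 : lebesgue_measure `[0%R, 1%R] = 1%E :> \bar R.
  by rewrite lebesgue_measure_itv/= lte_fin ltr01 oppr0 adde0.
have int01 g : bmeas g -> (@lebesgue_measure R).-integrable `[0%R, 1%R] (EFin \o g).
  by move=> bg; apply: bmeas_integrable => //; rewrite [X in (X < _)%E]leb1 ltry.
have : Rintegral (@lebesgue_measure R) `[0%R, 1%R] (fun x => f x + M) =
       \int[unif01 R]_x (f x + M).
  rewrite /Rintegral /unif01 integral_uniform ?subr0 ?invr1 ?mul1e//.
  by apply/measurable_EFinP; case: bfM.
rewrite expectationD//; last exact: bmeas_cst.
rewrite (expectation_cst (unif01 R)) RintegralD//; last 2 first.
- exact: int01.
- by apply: int01; exact: bmeas_cst.
rewrite (Rintegral_cst _ _ M)//= [X in fine X]leb1 mulr1.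
exact: addIr.
Qed.

End unit_interval.

Section cint_pointwise.
Variable R : realType.

Lemma updE (I : eqType) (y : I -> R) i t j : upd y i t j = if j == i then t else y j.
Proof. by []. Qed.

Lemma eq_int01 (f g : R -> R) : (forall t, f t = g t) ->
  Rintegral (@lebesgue_measure R) `[0%R, 1%R] f =
  Rintegral (@lebesgue_measure R) `[0%R, 1%R] g.
Proof. by move=> fg; have -> : f = g by exact/funext. Qed.

Lemma cint_cat (I : eqType) (s1 s2 : seq I) (f : (I -> R) -> R) y :
  cint (s1 ++ s2) f y = cint s1 (cint s2 f) y.
Proof.
by elim: s1 y => //= i s1 IH y; apply: eq_Rintegral => t _; exact: IH.
Qed.

(** Every coordinate of [s] is overwritten before [f] is evaluated. This is what makes the
    placeholder values 0 in [cube_int] and [lab] harmless. *)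
Lemma eq_cint_point (I : eqType) (s : seq I) (f : (I -> R) -> R) y y' :
  (forall i, i \notin s -> y i = y' i) -> cint s f y = cint s f y'.
Proof.
elim: s y y' => [|i s IH] y y' yy' /=.
  by congr f; apply/funext => i; exact: yy'.
apply: eq_Rintegral => t _; apply: IH => j js; rewrite !updE.
by case: eqP => // /eqP ji; apply: yy'; rewrite inE negb_or ji.
Qed.

Definition upd_invariant (I : eqType) (i : I) (f : (I -> R) -> R) :=
  forall y t, f (upd y i t) = f y.

Lemma upd_comm (I : eqType) (y : I -> R) i j t u : i != j ->
  upd (upd y i t) j u = upd (upd y j u) i t.
Proof.
move=> ij; apply/funext => x; rewrite !updE.
by case: (eqVneq x j) => [->|//]; rewrite eq_sym (negbTE ij).
Qed.

Lemma cint_upd_invariant (I : eqType) (i : I) s f : i \notin s ->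
  upd_invariant i f -> upd_invariant i (cint s f).
Proof.
move=> + fi; elim: s => //= j s IH; rewrite inE negb_or => /andP[ij iNs] y t.
apply: eq_Rintegral => u _; rewrite upd_comm// IH//.
Qed.

Lemma cint_reindex (I J : eqType) (h : I -> J) s (f : (I -> R) -> R) y :
  injective h ->
  cint (map h s) (fun z => f (fun i => z (h i))) y = cint s f (fun i => y (h i)).
Proof.
move=> hI; elim: s y => //= i s IH y; apply: eq_Rintegral => t _.
rewrite IH; congr (cint _ _ _); apply/funext => j.
by rewrite !updE (inj_eq hI).
Qed.

End cint_pointwise.

Section cint_measurable.
Variables (R : realType) (I : finType).
Implicit Types (f g : (I -> R) -> R) (s : seq I) (y : I -> R).

Lemma bmeas_section f i y : cmeas f -> bmeas (fun t : R => f (upd y i t)).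
Proof.
move=> bf; apply: (@bmeas_comp _ _ (coords R I) _ _ (fun t => upd y i t : coords R I) f) => //.
apply: measurable_coords => j; rewrite /upd.
by case: (j == i); [exact: measurable_id|exact: measurable_cst].
Qed.

Lemma cmeas_integrate f i : cmeas f ->
  cmeas (fun y => Rintegral (@lebesgue_measure R) `[0%R, 1%R]
                    (fun t => f (upd y i t))).
Proof.
move=> bf.
have bu : @bmeas _ (measurableTypeR R * coords R I)%type R (fun z => f (upd z.2 i z.1)).
  exact: (bmeas_comp (@measurable_upd R I i) bf).
apply: (eq_bmeas _ (bmeas_expectation (unif01 R) bu)) => y /=.
by rewrite Rintegral01E//; exact: bmeas_section.
Qed.

Lemma cmeas_cint s f : cmeas f -> cmeas (cint s f).
Proof. by move=> bf; elim: s => //= i s IH; exact: cmeas_integrate. Qed.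

Lemma le_cint s f g y : cmeas f -> cmeas g -> (forall z, f z <= g z) ->
  cint s f y <= cint s g y.
Proof.
move=> bf bg fg; elim: s y => //= i s IH y.
have := bmeas_section i y (cmeas_cint s bf).
have := bmeas_section i y (cmeas_cint s bg).
by move=> bg' bf'; rewrite !Rintegral01E//; exact: le_expectation.
Qed.

Lemma cint_cst s c y : cint s (fun=> c) y = c.
Proof.
elim: s y => //= i s IH y.
rewrite (@eq_int01 R _ (cst c)) => [|t]; last exact: IH.
by rewrite Rintegral01E; [exact: expectation_cst|exact: bmeas_cst].
Qed.

Lemma cintD s f g y : cmeas f -> cmeas g ->
  cint s (fun z => f z + g z) y = cint s f y + cint s g y.
Proof.
move=> bf bg; elim: s y => //= i s IH y.
have bf' := bmeas_section i y (cmeas_cint s bf).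
have bg' := bmeas_section i y (cmeas_cint s bg).
rewrite (eq_int01 (fun t => IH _)).
by rewrite !Rintegral01E// ?expectationD//; exact: bmeasD.
Qed.

Lemma cintM_invariant s f g y : cmeas g -> (forall i, i \in s -> upd_invariant i f) ->
  cint s (fun z => f z * g z) y = f y * cint s g y.
Proof.
move=> bg; elim: s y => //= i s IH y fs.
have bg' := bmeas_section i y (cmeas_cint s bg).
rewrite (@eq_int01 R _ (fun t => f y * cint s g (upd y i t))) => [|t].
  by rewrite !Rintegral01E ?expectationZ//; exact: bmeasZ.
by rewrite IH => [|j js]; [rewrite fs ?mem_head|apply: fs; rewrite inE js orbT].
Qed.

Lemma cintZ s c f y : cmeas f -> cint s (fun z => c * f z) y = c * cint s f y.
Proof. by move=> bf; rewrite (@cintM_invariant s (fun=> c)). Qed.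

(* Blocks [L k] of coordinates are integrated one after the other; the factors
   attached to the other blocks are constants for the current one. *)
Lemma cint_blocks (K : eqType) (L : K -> seq I) (a : (I -> R) -> R)
    (F : K -> (I -> R) -> R) (ss : seq K) y :
  uniq ss -> cmeas a -> (forall k, cmeas (F k)) ->
  (forall k i, i \in L k -> upd_invariant i a) ->
  (forall k k' i, k != k' -> i \in L k -> upd_invariant i (F k')) ->
  (forall k k' i, k != k' -> i \in L k -> i \notin L k') ->
  cint (flatten (map L ss)) (fun z => a z * \prod_(k <- ss) F k z) y =
  a y * \prod_(k <- ss) cint (L k) (F k) y.
Proof.
move=> + ba bF La LF LL; elim: ss y => [|k ss IH] y /=.
  by rewrite big_nil => _; congr (_ * _); rewrite big_nil.
move=> /andP[kss uss].
have ksne k' : k' \in ss -> k' != k.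
  by move=> k'ss; apply: contraNneq kss => <-.
have bprod : cmeas (fun z => \prod_(j <- ss) F j z) by exact: bmeas_prod.
rewrite cint_cat.
have -> : cint (flatten (map L ss)) (fun z => a z * \prod_(j <- (k :: ss)) F j z) =
    (fun z => (a z * \prod_(j <- ss) cint (L j) (F j) z) * F k z).
  apply/funext => z; rewrite mulrC -IH//.
  rewrite -cintM_invariant; last 2 first.
  - exact: bmeasM.
  - move=> i /flattenP[_ /mapP[k' k'ss ->] iL].
    by apply: (LF k' k) => //; exact: ksne.
  congr (cint _ _ _); apply/funext => u; rewrite big_cons.
  by rewrite mulrCA.
rewrite cintM_invariant//; last first.
  move=> i iL z t; rewrite (La k)//; congr (_ * _).
  rewrite !big_seq; apply: eq_bigr => j jss.
  have kj : k != j by rewrite eq_sym ksne.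
  by rewrite (cint_upd_invariant (LL _ _ _ kj iL))//; exact: (LF k).
by rewrite big_cons -mulrA; congr (_ * _); rewrite mulrC.
Qed.

End cint_measurable.

(** * Resampling the coordinates of an i.i.d. uniform sample *)

Section iid.
Context (R : realType) (dO : measure_display) (Omega : measurableType dO).
Variables (P : probability Omega R) (X : nat -> Omega -> R).
Hypothesis hX : iid_uniform P X.

Definition sample N (w : Omega) : coords R 'I_N := fun i => X i w.
Arguments sample : clear implicits.

Lemma measurable_sample N : measurable_fun setT (sample N).
Proof. by apply: measurable_coords => i; exact: hX.1. Qed.

Lemma bmeas_sample N (f : ('I_N -> R) -> R) : cmeas f -> bmeas (fun w => f (sample N w)).
Proof. by apply: bmeas_comp; exact: measurable_sample. Qed.

Lemma measurable_box N (B : 'I_N -> set R) : (forall i, measurable (B i)) ->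
  measurable (sample N @^-1` [set y | forall i, B i (y i)]).
Proof.
move=> mB; rewrite -[X in measurable X]setTI; apply: measurable_sample => //.
by apply: sub_sigma_algebra; exists B.
Qed.

Lemma sample_box N (B : 'I_N -> set R) : (forall i, measurable (B i)) ->
  P (sample N @^-1` [set y | forall i, B i (y i)]) =
  (\prod_(i < N) fine (lebesgue_measure (B i `&` `[0%R, 1%R])))%:E.
Proof.
move=> mB; rewrite -(hX.2 N B mB) -[in LHS](setIT (sample N @^-1` _)).
rewrite -integral_indic//; last exact: measurable_box.
apply: eq_integral => w _; congr EFin; rewrite indicE.
case: (boolP (w \in _)); rewrite ?inE ?notin_setE /=.
  by move=> Bw; rewrite big1// => i _; rewrite indicE mem_set//; exact: Bw.
move=> /existsNP[i Bi]; rewrite (bigD1 i)//= indicE.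
by rewrite memNset// mul0r.
Qed.

(** Both sides integrate [f] against a law on [coords]: that of the sample, and that of the sample
    with coordinate [i] replaced by an independent uniform point. The two laws agree on boxes, since
    in [sample_box] the [i]-th factor splits off. *)
Lemma sample_integrate N (i : 'I_N) (f : ('I_N -> R) -> R) : cmeas f ->
  \int[P]_w f (sample N w) =
  \int[P]_w Rintegral (@lebesgue_measure R) `[0%R, 1%R]
    (fun t => f (upd (sample N w) i t)).
Proof.
move=> bf.
have mu : measurable_fun setT
    (fun z : measurableTypeR R * Omega => upd (sample N z.2) i z.1 : coords R 'I_N).
  apply: (measurableT_comp (measurable_upd i)
    (g := fun z : R * Omega => (z.1, sample N z.2))).
  apply: measurable_fun_pair; first exact: measurable_fst.
  apply: measurableT_comp; [exact: measurable_sample|exact: measurable_snd].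
have bfu : @bmeas _ (measurableTypeR R * Omega)%type R (fun z => f (upd (sample N z.2) i z.1)).
  exact: (@bmeas_comp _ _ (coords R 'I_N) _ _ _ f mu).
have -> : (\int[P]_w Rintegral (@lebesgue_measure R) `[0%R, 1%R]
    (fun t => f (upd (sample N w) i t))) =
    \int[P]_w (\int[unif01 R]_t f (upd (sample N w) i t)).
  by apply: eq_Rintegral => w _; rewrite Rintegral01E//; exact: bmeas_section.
rewrite -(expectation_fubini (unif01 R) P bfu).
congr fine.
have mfE : measurable_fun setT (EFin \o f : coords R 'I_N -> _).
  by apply/measurable_EFinP; case: bf.
have := @integral_pushforward _ _ _ _ _ _ (@measurable_sample N) P setT _ mfE
  (bmeas_integrableT P (bmeas_sample bf)) measurableT.
rewrite preimage_setT => <-.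
have := @integral_pushforward _ _ _ _ _ _ mu (unif01 R \x P)%E setT _ mfE
  (bmeas_integrableT (unif01 R \x P)%E bfu) measurableT.
rewrite preimage_setT => <-.
pose sample_mfun : {mfun Omega >-> coords R 'I_N} :=
  HB.pack (sample N) (isMeasurableFun.Build _ _ _ _ _ (@measurable_sample N)).
pose upd_mfun : {mfun (measurableTypeR R * Omega)%type >-> coords R 'I_N} :=
  HB.pack (fun z : measurableTypeR R * Omega => upd (sample N z.2) i z.1 : coords R 'I_N)
    (isMeasurableFun.Build _ _ _ _ _ mu).
apply: (@eq_measure_integral _ _ _ setT
  (pushforward (unif01 R \x P)%E upd_mfun) (pushforward P sample_mfun)) => A mA _.
apply: (@measure_unique _ R (coords R 'I_N) (@boxes R 'I_N) (fun=> setT) _ _ _ _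
  (pushforward P sample_mfun) (pushforward (unif01 R \x P)%E upd_mfun)) => //.
- exact: boxes_setI.
- by move=> _; exact: boxes_setT.
- by apply/seteqP; split => // y _; exists 0%N.
- move=> _ [B mB <-].
  (* Once coordinate [i] has been redrawn, its old value is unconstrained, hence [setT]; the
     corresponding factor is the length 1 of the unit interval. *)
  pose C j := if j == i then setT else B j.
  have mC j : measurable (C j) by rewrite /C; case: ifP.
  rewrite /pushforward [LHS](sample_box mB).
  have preE : upd_mfun @^-1` [set y | forall i, B i (y i)] =
      B i `*` (sample N @^-1` [set y | forall j, C j (y j)]).
    apply/seteqP; split => -[t w] /=.
      move=> Bu; split; first by have := Bu i; rewrite updE eqxx.
      by move=> j; rewrite /C; case: eqP => // /eqP ji; have := Bu j;
        rewrite updE (negbTE ji).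
    move=> [Bt Cw] j; rewrite updE; case: eqP => [->//|/eqP ji].
    by have := Cw j; rewrite /C (negbTE ji).
  apply: (etrans _ (esym (f_equal (unif01 R \x P)%E preE))).
  rewrite [RHS]product_measure1E//; last exact: measurable_box.
  rewrite [X in (_ * X)%E](sample_box mC).
  rewrite (bigD1 i)//= [in RHS](bigD1 i)//= {1}/C eqxx setTI.
  rewrite (_ : fine (lebesgue_measure `[0%R, 1%R]) = 1); last first.
    by rewrite lebesgue_measure_itv/= lte_fin ltr01 oppr0 adde0.
  rewrite mul1r EFinM; congr (_ * _)%E.
    rewrite uniform01E// fineK// ge0_fin_numE//.
    apply: (@le_lt_trans _ _ (lebesgue_measure `[0%R, 1%R] : \bar R)).
      apply: le_measure; rewrite ?inE.
      - by apply: measurableI => //; exact: mB.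
      - exact: measurable_itv.
      - exact: subIsetr.
    by rewrite lebesgue_measure_itv/= lte_fin ltr01 oppr0 adde0 ltry.
  by congr EFin; apply: eq_bigr => j ji; rewrite /C (negbTE ji).
  exact: mB.
by move=> n; rewrite [X in (X < _)%E](probability_setT P) ltry.
Qed.

(** Resampling the coordinates of [s] one after the other. When the iterated integral is constant
    this evaluates the expectation; when [s] lists only some vertices, the others stay random. *)
Lemma sample_cint N (s : seq 'I_N) (f : ('I_N -> R) -> R) : cmeas f ->
  \int[P]_w f (sample N w) = \int[P]_w cint s f (sample N w).
Proof.
move=> bf; elim: s => //= i s ->; rewrite (sample_integrate i)//.
exact: cmeas_cint.
Qed.

End iid.

Arguments sample {R dO Omega} X N w.

(** * Averages over finite sets *)

Section averages.
Variable R : realFieldType.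

(** Since the inverse of 0 is 0, an average over the empty set is 0, a value still in [0,1].
    [Gamma_n] has this form by definition and [tinj] by [tinjE]. *)
Definition avg (T : finType) (A : {set T}) (f : T -> R) : R :=
  (#|A|%:R)^-1 * \sum_(a in A) f a.

Lemma le_avg (T : finType) (A : {set T}) (f g : T -> R) : (forall a, a \in A -> f a <= g a) ->
  avg A f <= avg A g.
Proof. by move=> fg; rewrite ler_wpM2l ?invr_ge0//; exact: ler_sum. Qed.

Lemma eq_avg (T : finType) (A : {set T}) (f g : T -> R) : (forall a, a \in A -> f a = g a) ->
  avg A f = avg A g.
Proof. by move=> fg; congr (_ * _); exact: eq_bigr. Qed.

Lemma avg_cst (T : finType) (A : {set T}) c : (0 < #|A|)%N -> avg A (fun=> c) = c.
Proof.
by move=> A0; rewrite /avg sumr_const -(mulr_natl c) mulrA mulVf ?mul1r// pnatr_eq0 -lt0n.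
Qed.

Lemma avgB (T : finType) (A : {set T}) (f g : T -> R) :
  avg A (fun a => f a - g a) = avg A f - avg A g.
Proof. by rewrite /avg sumrB mulrBr. Qed.

Lemma avg_sum (T K : finType) (p : pred K) (A : {set T}) (f : K -> T -> R) :
  avg A (fun a => \sum_(k | p k) f k a) = \sum_(k | p k) avg A (f k).
Proof. by rewrite /avg exchange_big/= mulr_sumr. Qed.

Lemma avg_ge0 (T : finType) (A : {set T}) (f : T -> R) : (forall a, a \in A -> 0 <= f a) ->
  0 <= avg A f.
Proof. by move=> f0; rewrite mulr_ge0 ?invr_ge0//; exact: sumr_ge0. Qed.

Lemma avg_le1 (T : finType) (A : {set T}) (f : T -> R) : (forall a, a \in A -> f a <= 1) ->
  avg A f <= 1.
Proof.
have [->|A0] := eqVneq A finset.set0.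
  by rewrite /avg big_set0 mulr0.
rewrite -card_gt0 in A0.
by move=> f1; rewrite -[leRHS](avg_cst 1 A0); exact: le_avg.
Qed.

Lemma avg_dist (T : finType) (A : {set T}) (f g : T -> R) e : 0 <= e ->
  (forall a, a \in A -> `|f a - g a| <= e) -> `|avg A f - avg A g| <= e.
Proof.
move=> e0 fg; rewrite -avgB /avg normrM ger0_norm ?invr_ge0//.
have [->|A0] := eqVneq A finset.set0; first by rewrite big_set0 normr0 mulr0.
rewrite -card_gt0 in A0; rewrite -[leRHS](avg_cst e A0).
rewrite ler_wpM2l ?invr_ge0// (le_trans (ler_norm_sum _ _ _))//.
exact: ler_sum.
Qed.

(** Every replacement of injective words by arbitrary ones goes through this bound, with [A] the
    arbitrary words and [B] the injective ones. *)
Lemma avg_subset_dist (T : finType) (A B : {set T}) (f : T -> R) : B \subset A ->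
  (forall a, 0 <= f a <= 1) ->
  `|avg B f - avg A f| <= avg A (fun a => (a \notin B)%:R).
Proof.
move=> BA f01; have [A0|A0] := eqVneq A finset.set0.
  have B0 : B = finset.set0 by apply/eqP; rewrite -finset.subset0 -A0.
  by rewrite /avg A0 B0 !big_set0 !mulr0 subr0 normr0.
rewrite -card_gt0 in A0.
have A0' : 0 < #|A|%:R :> R by rewrite ltr0n.
have split_sum g : \sum_(a in A) g a =
    \sum_(a in B) g a + \sum_(a in A | a \notin B) g a :> R.
  rewrite (bigID (fun a => a \in B))/=; congr (_ + _); apply: eq_bigl => a.
  by apply/andP/idP => [[]//|aB]; rewrite aB (fintype.subsetP BA).
have sB1 : \sum_(a in B) f a <= #|B|%:R.
  by rewrite -[leRHS]mulr1 mulr_natl -sumr_const; apply: ler_sum => a _; case/andP: (f01 a).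
have sB0 : 0 <= \sum_(a in B) f a by apply: sumr_ge0 => a _; case/andP: (f01 a).
set sB := \sum_(a in B) f a in sB0 sB1.
set b : R := \sum_(a in A | a \notin B) 1.
have bE : b = #|A|%:R - #|B|%:R.
  have := split_sum (fun=> 1); rewrite /= -/b !sumr_const => ->.
  by rewrite addrC addKr.
have sD1 : \sum_(a in A | a \notin B) f a <= b.
  by apply: ler_sum => a _; case/andP: (f01 a).
have sD0 : 0 <= \sum_(a in A | a \notin B) f a.
  by apply: sumr_ge0 => a _; case/andP: (f01 a).
have -> : avg A (fun a => (a \notin B)%:R) = b / #|A|%:R.
  rewrite mulrC /avg split_sum big1 ?add0r => [|a ->//].
  by congr (_ * _); apply: eq_bigr => a /andP[_ ->].
rewrite /avg split_sum -/sB.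
set sD := \sum_(a in A | _) _ in sD0 sD1 *.
rewrite ler_pdivlMr// -[X in _ * X <= _](ger0_norm (ltW A0')) -normrM.
rewrite mulrBl (mulrC _ (sB + sD)) divfK ?gt_eqF//.
have [B0|B0] := eqVneq #|B| 0%N.
  have -> : sB = 0 by apply/eqP; rewrite eq_le sB0 andbT; rewrite B0 in sB1.
  by rewrite mulr0 mul0r !add0r normrN ger0_norm.
have B0' : 0 < #|B|%:R :> R by rewrite ltr0n lt0n.
have -> : #|A|%:R = b + #|B|%:R by rewrite bE subrK.
(* Multiplied by [#|A|%:R = b + #|B|%:R], the difference of the averages becomes
   [#|B|%:R^-1 * sB * b - sD], a difference of two numbers in [0, b]. *)
rewrite mulrDr (mulrAC _ sB #|B|%:R) mulVf ?gt_eqF// mul1r.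
have : 0 <= #|B|%:R^-1 * sB * b <= b.
  have b0 : 0 <= b by exact: le_trans sD1.
  rewrite mulr_ge0 ?(mulr_ge0, invr_ge0)//= ler_piMl//.
  by rewrite mulrC ler_pdivrMr// mul1r.
move: (_ * b) => x xb.
by rewrite ler_norml; apply/andP; split; lra.
Qed.

Lemma avg_prod (I T : finType) (f : I -> T -> R) :
  \prod_(i : I) avg [set: T] (f i) =
  avg [set: {ffun I -> T}] (fun z => \prod_i f i (z i)).
Proof.
rewrite /avg big_split/= prodr_const !cardsT card_ffun natrX exprVn.
congr (_ * _).
rewrite (eq_bigr (fun i => \sum_(t in predT) f i t)) => [|i _].
  rewrite bigA_distr_bigA /=.
  by apply: eq_big => // z; rewrite inE.
by apply: eq_bigl => t; rewrite inE.
Qed.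

Lemma avg_pair (T1 T2 : finType) (f : T1 -> T2 -> R) :
  avg [set: T1] (fun a => avg [set: T2] (f a)) =
  avg [set: T1 * T2] (fun z => f z.1 z.2).
Proof.
rewrite /avg !cardsT card_prod natrM invfM -mulrA; congr (_ * _).
rewrite -mulr_sumr; congr (_ * _); rewrite pair_big/=.
by apply: eq_bigl => z; rewrite !inE.
Qed.

Lemma avg_bij (T1 T2 : finType) (h : T1 -> T2) (f : T2 -> R) : bijective h ->
  avg [set: T1] (fun a => f (h a)) = avg [set: T2] f.
Proof.
move=> hb; rewrite /avg !cardsT (bij_eq_card hb); congr (_ * _).
rewrite [RHS](reindex h) /=; last exact: onW_bij.
by apply: eq_bigl => t; rewrite !inE.
Qed.

End averages.

(** * Collision probabilities of uniformly random maps *)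

Section resampling.
Variables (R : realFieldType) (V T : finType).

Definition fupd (z : {ffun V -> T}) i t := [ffun j => if j == i then t else z j].

(** Exchanging the letter [z i] with the additional letter [t] is an involution of the pairs, so
    redrawing a letter only permutes them: the finite counterpart of [sample_integrate]. *)
Lemma sum_resample (i : V) (f : {ffun V -> T} -> R) :
  \sum_z \sum_t f (fupd z i t) = #|T|%:R * \sum_z f z.
Proof.
pose h (zt : {ffun V -> T} * T) := (fupd zt.1 i zt.2, zt.1 i).
have hK : involutive h.
  move=> [z t]; rewrite /h/= ffunE eqxx; congr pair.
  by apply/ffunP => j; rewrite !ffunE; case: eqP => // ->.
rewrite (pair_big xpredT xpredT)/= (reindex_inj (inv_inj hK))/=.
rewrite -(pair_big xpredT xpredT (fun z t => f (fupd (fupd z i t) i (z i))))/=.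
rewrite mulr_sumr; apply: eq_bigr => z _; rewrite mulr_natl -sumr_const.
apply: eq_bigr => t _; congr f.
by apply/ffunP => j; rewrite !ffunE; case: eqP => // ->.
Qed.

(** [h] does not look at position [i], so the letter there is uniform whatever the value of
    [h z]. *)
Lemma avg_collision (i : V) (h : {ffun V -> T} -> T) : (0 < #|T|)%N ->
  (forall z t, h (fupd z i t) = h z) ->
  avg [set: {ffun V -> T}] (fun z => (z i == h z)%:R) = (#|T|%:R)^-1 :> R.
Proof.
move=> T0 hi.
have T0' : #|T|%:R != 0 :> R by rewrite pnatr_eq0 -lt0n.
apply: (mulfI T0'); rewrite divff// /avg mulrCA.
rewrite (eq_bigl xpredT) => [|z]; last by rewrite inE.
rewrite -(sum_resample i).
rewrite (eq_bigr (fun=> 1)) => [|z _].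
  rewrite sumr_const cardsT mulVf// pnatr_eq0 card_ffun expn_eq0.
  by rewrite negb_and -lt0n T0.
rewrite (bigD1 (h z))//= hi ffunE eqxx eqxx big1 ?addr0// => t tz.
by rewrite hi ffunE eqxx (negbTE tz).
Qed.

End resampling.

Section collisions.
Variable R : realFieldType.

Lemma noninjective_le (V T : finType) (b : V -> T) :
  (~~ injectiveb b)%:R <= \sum_(u : V) \sum_(v | v != u) (b u == b v)%:R :> R.
Proof.
have s0 u : 0 <= \sum_(v | v != u) (b u == b v)%:R :> R by exact: sumr_ge0.
have [_|/injectivePn[u [v uv buv]]] := boolP (injectiveb b).
  by apply: sumr_ge0 => u _; exact: s0.
rewrite /= (bigD1 u)//= ler_wpDr//; first by apply: sumr_ge0 => w _; exact: s0.
by rewrite (bigD1 v) 1?eq_sym//= buv eqxx lerDl sumr_ge0.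
Qed.

Lemma sum_offdiag_le (V : finType) (e : V -> V -> R) (c : R) : 0 <= c ->
  (forall u v, v != u -> e u v <= c) ->
  \sum_(u : V) \sum_(v | v != u) e u v <= (#|V| ^ 2)%:R * c.
Proof.
move=> c0 ec; apply: (@le_trans _ _ (\sum_(u : V) \sum_(v : V) c)).
  apply: ler_sum => u _; rewrite [leRHS](bigID (fun v => v != u))/=.
  rewrite ler_wpDr//; first by apply: sumr_ge0.
  by apply: ler_sum => v; exact: ec.
by rewrite !sumr_const -mulrnA mulr_natl mulnn.
Qed.

Lemma avg_noninjective_ffun (V : finType) (n : nat) : (0 < n)%N ->
  avg [set: {ffun V -> 'I_n}] (fun z => (~~ injectiveb z)%:R) <=
  (#|V| ^ 2)%:R / n%:R :> R.
Proof.
move=> n0; apply: (@le_trans _ _ (avg [set: {ffun V -> 'I_n}]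
  (fun z => \sum_u \sum_(v | v != u) (z u == z v)%:R))).
  by apply: le_avg => z _; exact: noninjective_le.
rewrite avg_sum; under eq_bigr do rewrite avg_sum.
apply: sum_offdiag_le => [|u v vu]; first by rewrite invr_ge0.
rewrite (@avg_collision R V _ u (fun z => z v)) ?card_ord// => z t.
by rewrite ffunE (negbTE vu).
Qed.

(** Telescoping: the factors are exchanged one at a time while all the others lie in [0,1]. *)
Lemma prod_dist (K : Type) (s : seq K) (a b : K -> R) :
  (forall i, 0 <= a i <= 1) -> (forall i, 0 <= b i <= 1) ->
  `|\prod_(i <- s) a i - \prod_(i <- s) b i| <= \sum_(i <- s) `|a i - b i|.
Proof.
move=> a01 b01; elim: s => [|i s IH]; first by rewrite !big_nil subrr normr0.
rewrite !big_cons.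
have -> : a i * \prod_(j <- s) a j - b i * \prod_(j <- s) b j =
  (a i - b i) * \prod_(j <- s) a j + b i * (\prod_(j <- s) a j - \prod_(j <- s) b j).
  by ring.
rewrite (le_trans (ler_normD _ _))// lerD// normrM.
  rewrite ler_piMr// ger0_norm; last by apply: prodr_ge0 => j _; case/andP: (a01 j).
  by apply: prodr_ile1 => j _; exact: a01.
have /andP[b0 b1] := b01 i.
by apply: le_trans IH; rewrite ler_piMl// ger0_norm.
Qed.

End collisions.

(** * Uniform extensions of a word prescribed on the labels *)

Section overwrite.
Variables (p k : nat) (l : 'I_k -> 'I_p).
Hypothesis hl : injective l.

(** One operation with several uses: [lab l x] is [over l x] applied to the zero function, an
    extension of [a] is [over l a z], and [vtx] attaches copies of a graph to common labels in the
    same way. *)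
Definition over (T : Type) (a : 'I_k -> T) (z : 'I_p -> T) (q : 'I_p) : T :=
  if [pick i | l i == q] is Some i then a i else z q.

Variant over_spec (T : Type) (a : 'I_k -> T) (z : 'I_p -> T) q : bool -> T -> Prop :=
  | OverLabelled i of l i = q : over_spec a z q true (a i)
  | OverUnlabelled of (forall i, l i != q) : over_spec a z q false (z q).

Lemma overP (T : Type) (a : 'I_k -> T) z q : over_spec a z q (labelled l q) (over a z q).
Proof.
rewrite /over /labelled; case: pickP => [i /eqP li|lN].
  have -> : [exists i, l i == q] by apply/existsP; exists i; rewrite li.
  exact: OverLabelled.
have -> : [exists i, l i == q] = false by apply/existsP => -[i]; rewrite lN.
by apply: OverUnlabelled => i; rewrite lN.
Qed.

Lemma over_label (T : Type) (a : 'I_k -> T) z i : over a z (l i) = a i.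
Proof. by case: overP => [j /hl ->//|/(_ i)]; rewrite eqxx. Qed.

Variable R : realFieldType.

Definition fover (T : finType) (a : 'I_k -> T) (z : 'I_p -> T) := [ffun q => over a z q].

Definition extensions (T : finType) (a : 'I_k -> T) : {set {ffun 'I_p -> T}} :=
  [set b : {ffun 'I_p -> T} | [forall i, b (l i) == a i]].

(** The involution [h] exchanges the letters of [z] at the labels with a separate word on the
    labels. Overwriting by [a] thus forgets k free letters, and each extension of [a] comes from
    [#|T| ^ k] words. *)
Lemma sum_over (T : finType) (a : 'I_k -> T) (f : {ffun 'I_p -> T} -> R) :
  \sum_(z : {ffun 'I_p -> T}) f (fover a z) = (#|T| ^ k)%:R * \sum_(b in extensions a) f b.
Proof.
pose h (za : {ffun 'I_p -> T} * {ffun 'I_k -> T}) :=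
  (fover za.2 za.1, [ffun i => za.1 (l i)]).
have hK : involutive h.
  move=> [z b]; rewrite /h/=; congr pair; apply/ffunP => q; rewrite !ffunE.
    case: overP => [i <-|qN]; rewrite ffunE//.
    by case: overP => // i li; have := qN i; rewrite li eqxx.
  by rewrite over_label.
(* [f'] ignores its second argument. Before the exchange the word [b] is therefore summed freely,
   giving the power of [#|T|]; after it, membership in [extensions a] forces [b] to be [a]. *)
pose f' (z : {ffun 'I_p -> T}) (b : {ffun 'I_k -> T}) := (z \in extensions a)%:R * f z.
have : \sum_z \sum_b f' z b =
    \sum_(z : {ffun 'I_p -> T}) \sum_(b : {ffun 'I_k -> T}) f' (fover b z) [ffun i => z (l i)].
  rewrite (pair_big xpredT xpredT)/= (reindex_inj (inv_inj hK))/=.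
  by rewrite -(pair_big xpredT xpredT (fun (z : {ffun 'I_p -> T})
    (b : {ffun 'I_k -> T}) => f' (fover b z) [ffun i => z (l i)])).
rewrite /f' [X in X = _ -> _](_ : _ = (#|T| ^ k)%:R * \sum_(b in extensions a) f b).
  move->; apply: eq_bigr => z _.
  rewrite (bigD1 [ffun i => a i])//= big1 ?addr0 => [|b ba].
    have -> : fover [ffun i => a i] z = fover a z.
      by apply/ffunP => q; rewrite !ffunE /over; case: pickP => // i; rewrite ffunE.
    rewrite inE (_ : [forall i, _] = true) ?mul1r//.
    by apply/forallP => i; rewrite ffunE over_label.
  rewrite inE; case: forallP => [ab|]; last by rewrite mul0r.
  case/eqP: ba; apply/ffunP => i; rewrite ffunE.
  by have /eqP := ab i; rewrite ffunE over_label.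
rewrite [in RHS]big_mkcond mulr_sumr; apply: eq_bigr => z _.
rewrite sumr_const -[LHS]mulr_natl card_ffun card_ord.
by case: ifP; rewrite ?mul1r ?mul0r ?mulr0.
Qed.

Lemma avg_over (T : finType) (a : 'I_k -> T) (f : {ffun 'I_p -> T} -> R) :
  (0 < #|T|)%N ->
  avg [set: {ffun 'I_p -> T}] (fun z => f (fover a z)) = avg (extensions a) f.
Proof.
move=> T0; rewrite /avg; have := sum_over a f; have := sum_over a (fun=> 1).
rewrite !sumr_const => c1 s1.
rewrite (eq_bigl xpredT) ?s1 => [|z]; last by rewrite inE.
rewrite cardsT c1 invfM mulrACA mulVf ?mul1r//.
by rewrite pnatr_eq0 expn_eq0 negb_and -lt0n T0.
Qed.

(** Two labelled positions carry distinct letters of the injective [a]. A pair with an unlabelled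
    position collides with probability at most 1/n, because the letter there is free of the other
    one. *)
Lemma avg_noninjective_over (n : nat) (a : 'I_k -> 'I_n) : (0 < n)%N -> injective a ->
  avg [set: {ffun 'I_p -> 'I_n}] (fun z => (~~ injectiveb (fover a z))%:R) <=
  (p ^ 2)%:R / n%:R :> R.
Proof.
move=> n0 aI; apply: (@le_trans _ _ (avg [set: {ffun 'I_p -> 'I_n}]
  (fun z => \sum_u \sum_(v | v != u) (fover a z u == fover a z v)%:R))).
  by apply: le_avg => z _; exact: noninjective_le.
rewrite avg_sum; under eq_bigr do rewrite avg_sum.
have -> : (p ^ 2 = #|'I_p| ^ 2)%N by rewrite card_ord.
apply: sum_offdiag_le => [|u v vu]; first by rewrite invr_ge0.
have unl (i j : 'I_p) : i != j -> ~~ labelled l i ->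
    avg [set: {ffun 'I_p -> 'I_n}] (fun z => (fover a z i == fover a z j)%:R) <=
    (n%:R)^-1 :> R.
  move=> ij iN; rewrite -[X in X%:R^-1]card_ord.
  rewrite -(@avg_collision R _ 'I_n i (fun z => over a z j)) ?card_ord//.
    by apply: le_avg => z _; rewrite !ffunE; move: iN; case: (overP a z i).
  move=> z t; rewrite /over; case: pickP => // _.
  by rewrite ffunE eq_sym (negbTE ij).
have [uL|] := boolP (labelled l u); last by apply: unl; rewrite eq_sym.
have [vL|] := boolP (labelled l v); last first.
  move=> /(unl _ _ vu); apply: le_trans; apply: le_avg => z _.
  by rewrite eq_sym.
apply: (@le_trans _ _ 0); last by rewrite invr_ge0.
rewrite /avg big1 ?mulr0// => z _.
rewrite !ffunE; move: uL vL.
case: (overP a z u) => // i li _; case: (overP a z v) => // j lj _.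
by case: eqP => // /aI ij; rewrite -li -lj ij eqxx in vu.
Qed.

Definition homb n (F : rel 'I_p) (G : rel nat) (b : 'I_p -> 'I_n) : bool :=
  [forall i : 'I_p, forall j : 'I_p, F i j ==> G (b i) (b j)].

End overwrite.

Section tinj_approximation.
Variables (R : realType) (p k : nat) (l : 'I_k -> 'I_p).
Hypothesis hl : injective l.

Lemma tinjE n F G (a : 'I_k -> 'I_n) :
  tinj R F l G a = avg (ext_words l a) (fun b => (homb F G b)%:R).
Proof.
have natr_if (c : bool) : (if c then 1%:R else 0) = c%:R :> R by case: c.
congr (_ * _); rewrite -sum1_card natr_sum big_mkcond [RHS]big_mkcond/=.
apply: eq_bigr => b _; rewrite !inE /homb.
by case: (injectiveb b && _) => //=; exact: natr_if.
Qed.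

Lemma tinj_bounds n F G (a : 'I_k -> 'I_n) : 0 <= tinj R F l G a <= 1.
Proof.
by rewrite tinjE; apply/andP; split; [apply: avg_ge0|apply: avg_le1] => b _;
  rewrite ?lern1 ?leq_b1.
Qed.

(** A free word overwritten by [a] is a uniform extension of [a]; only its noninjective outcomes
    separate the two averages. *)
Lemma tinj_approx n F G (a : 'I_k -> 'I_n) : (0 < n)%N -> injective a ->
  `|tinj R F l G a -
    avg [set: {ffun 'I_p -> 'I_n}] (fun z => (homb F G (fover l a z))%:R)| <=
  (p ^ 2)%:R / n%:R.
Proof.
move=> n0 aI; rewrite tinjE.
rewrite (avg_over hl a (fun b => (homb F G b)%:R)) ?card_ord//.
apply: (@le_trans _ _ (avg (extensions l a) (fun b => (b \notin ext_words l a)%:R))).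
  apply: avg_subset_dist => [|b]; last by case: homb; rewrite ?ler01 ?lexx.
  by apply/fintype.subsetP => b; rewrite !inE => /andP[].
rewrite -(avg_over hl a (fun b => (b \notin ext_words l a)%:R)) ?card_ord//.
apply: le_trans (avg_noninjective_over l R n0 aI).
apply: le_avg => z _; rewrite inE negb_and.
have -> : [forall i, fover l a z (l i) == a i].
  by apply/forallP => i; rewrite ffunE over_label.
by rewrite orbF.
Qed.

End tinj_approximation.

Lemma natr_forall (R : realFieldType) (I : finType) (b : pred I) :
  [forall i, b i]%:R = \prod_(i : I) (b i)%:R :> R.
Proof.
have [/forallP bT|/forallPn[i bi]] := boolP [forall i, b i].
  by rewrite big1// => i _; rewrite bT.
by rewrite (bigD1 i)//= (negbTE bi) mul0r.
Qed.

(** * Moments of [Gamma_n] as densities of a glued graph *)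

Section moments.
Variables (R : realType) (d p k r : nat) (F : 'I_d -> rel 'I_p) (l : 'I_k -> 'I_p).
Hypothesis hl : injective l.
Variable m : 'I_r -> 'I_d.

(* Vertices of the graph obtained by gluing F_(m 0), ..., F_(m (r-1)) along the
   labels; the vertices inr (s, l i) are isolated and play no role. *)
Definition glued := ('I_k + 'I_r * 'I_p)%type.

Definition vtx (s : 'I_r) : 'I_p -> glued := over l inl (fun q => inr (s, q)).

Definition glue n (az : {ffun 'I_k -> 'I_n} * {ffun 'I_r -> {ffun 'I_p -> 'I_n}}) :
  {ffun glued -> 'I_n} :=
  [ffun v => match v with inl i => az.1 i | inr sq => az.2 sq.1 sq.2 end].

Lemma glue_bij n : bijective (@glue n).
Proof.
exists (fun t : {ffun glued -> 'I_n} =>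
  ([ffun i => t (inl i)], [ffun s => [ffun q => t (inr (s, q))]])).
  move=> [a z]; congr pair; apply/ffunP => i; rewrite !ffunE//.
  by apply/ffunP => q; rewrite !ffunE.
by move=> t; apply/ffunP => -[i|[s q]]; rewrite !ffunE.
Qed.

Lemma glue_vtx n az s q : @glue n az (vtx s q) = over l az.1 (az.2 s) q.
Proof. by rewrite ffunE /vtx /over; case: pickP. Qed.

Definition glued_hom n (G : rel nat) (t : glued -> 'I_n) : bool :=
  [forall s, homb (F (m s)) G (fun q => t (vtx s q))].

(** The error has two sources: [p ^ 2] over n for each of the r factors [tinj], whose extensions
    become free words, and [k ^ 2] over n for the label words, which become arbitrary maps. A
    product of r averages over free words is a single average over r-tuples of words, and together
    with the label word these are the maps on the glued vertices. *)
Lemma Gamma_n_moment n (G : rel nat) : (0 < n)%N ->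
  `|Gamma_n n F l G (fun v => \prod_s v ord0 (m s)) -
    avg [set: {ffun glued -> 'I_n}] (fun t => (glued_hom G t)%:R)| <=
  (r * p ^ 2 + k ^ 2)%:R / n%:R :> R.
Proof.
move=> n0.
pose u a s : R := avg [set: {ffun 'I_p -> 'I_n}]
  (fun z => (homb (F (m s)) G (fover l (a : 'I_k -> 'I_n) z))%:R).
have u01 a s : 0 <= u a s <= 1.
  by apply/andP; split; [apply: avg_ge0|apply: avg_le1] => b _;
    rewrite ?lern1 ?leq_b1.
have -> : avg [set: {ffun glued -> 'I_n}] (fun t => (glued_hom G t)%:R) =
    avg [set: {ffun 'I_k -> 'I_n}] (fun a => \prod_s u a s).
  rewrite -(avg_bij _ (glue_bij n)).
  rewrite -(avg_pair (fun a z => (glued_hom G (glue (a, z)))%:R)).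
  apply: eq_avg => a _; rewrite /u avg_prod; apply: eq_avg => z _.
  rewrite -natr_forall; congr ((nat_of_bool _)%:R); apply: eq_forallb => s.
  by congr homb; apply/funext => q; rewrite glue_vtx ffunE.
have prod01 (f : 'I_r -> R) : (forall s, 0 <= f s <= 1) -> 0 <= \prod_s f s <= 1.
  move=> f01; rewrite prodr_ge0 => [|s _]; last by case/andP: (f01 s).
  by rewrite prodr_ile1.
pose t a s : R := tinj R (F (m s)) l G (a : 'I_k -> 'I_n).
have t01 a s : 0 <= t a s <= 1 by exact: tinj_bounds.
rewrite (_ : Gamma_n _ _ _ _ _ = avg (words k n) (fun a => \prod_s t a s)); last first.
  by apply: eq_avg => a _; apply: eq_bigr => s _; rewrite mxE.
apply: (le_trans (ler_distD (avg (words k n) (fun a => \prod_s u a s)) _ _)).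
rewrite natrD mulrDl lerD//.
  apply: avg_dist => [|a]; first by rewrite divr_ge0.
  rewrite inE => /injectiveP aI.
  apply: (le_trans (prod_dist _ _ _)) => //.
  apply: (@le_trans _ _ (\sum_(s : 'I_r) (p ^ 2)%:R / n%:R)).
    by apply: ler_sum => s _; exact: tinj_approx.
  by rewrite sumr_const card_ord -mulrnAl -mulrnA mulnC.
apply: (@le_trans _ _ (avg [set: {ffun 'I_k -> 'I_n}] (fun a => (a \notin words k n)%:R))).
  apply: avg_subset_dist => [|a]; last exact: prod01.
  by apply/fintype.subsetP => a; rewrite inE.
rewrite (eq_avg (g := fun a : {ffun 'I_k -> 'I_n} => (~~ injectiveb a)%:R)) => [|a _].
  by have := avg_noninjective_ffun R 'I_k n0; rewrite card_ord.
by rewrite inE.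
Qed.

End moments.

(** * Densities in the random graph *)

Section random_graph.
Context (R : realType) (dO : measure_display) (Omega : measurableType dO).
Variables (P : probability Omega R) (W : R -> R -> R) (X : nat -> Omega -> R).
Variable xi : nat -> nat -> Omega -> bool.
Hypotheses (hW : graphon W) (hX : iid_uniform P X) (hxi : edge_law P W X xi).

Let xi_meas i j : measurable [set w | xi i j w]. Proof. by case: hxi. Qed.
Let xi_sym i j w : xi i j w = xi j i w. Proof. by case: hxi => _ /(_ i j w). Qed.

Lemma bmeas_edge i j : bmeas (fun w => (xi i j w)%:R : R).
Proof.
apply: (eq_bmeas _ (bmeas_indic R (xi_meas i j))) => w.
rewrite indicE; case: (boolP (xi i j w)) => xiw; first by rewrite mem_set.
by rewrite memNset//; exact/negP.
Qed.

Lemma bmeas_graphon dS (S : measurableType dS) (f g : S -> R) :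
  measurable_fun setT f -> measurable_fun setT g -> bmeas (fun x => W (f x) (g x)).
Proof.
move=> mf mg; have [mW _ W01] := hW; split.
  apply: (measurableT_comp mW (g := fun x => (f x, g x))).
  exact: measurable_fun_pair.
by exists 1 => x; have /andP[? ?] := W01 (f x) (g x); rewrite ger0_norm.
Qed.

(* The edge law only speaks of pairs [q.1 < q.2]: orient each pair {a e, b e}. *)
Lemma edge_expectation (E : finType) (D : {set E}) N (a b : E -> 'I_N) :
  (forall e, e \in D -> a e != b e) ->
  {in D &, forall e e', (a e = a e' /\ b e = b e') \/ (a e = b e' /\ b e = a e') -> e = e'} ->
  \int[P]_w \prod_(e in D) (xi (a e) (b e) w)%:R =
  \int[P]_w \prod_(e in D) W (X (a e) w) (X (b e) w).
Proof.
move=> abD injD.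
pose f e := if (a e < b e)%N then (a e, b e) else (b e, a e).
have f_inj : {in D &, injective f}.
  move=> e e' eD e'D; rewrite /f.
  by case: ifP => _; case: ifP => _ [h1 h2]; apply: injD => //; auto.
have f_lt q : q \in f @: D -> (q.1 < q.2)%N.
  case/imsetP => e eD ->; rewrite /f; case: ifP => //= /negbT; rewrite -leqNgt leq_eqVlt.
  by case/orP => // /eqP/val_inj ba; have := abD e eD; rewrite ba eqxx.
have [_ W_sym _] := hW; have [_ _ law] := hxi.
have := law N (fun=> setT) (f @: D) (fun _ _ => true) (fun=> measurableT) f_lt.
have idc w : \prod_(i < N) \1_[set: R] (X i w) = 1 :> R.
  by rewrite big1// => i _; rewrite indicE in_setT.
rewrite /Rintegral => lawE; congr fine.
transitivity ((\int[P]_w ((\prod_(i < N) \1_[set: R] (X i w)) *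
     \prod_(q in f @: D) (xi q.1 q.2 w == true)%:R)%:E)%E).
  apply: eq_integral => w _; rewrite idc mul1r big_imset//=; congr EFin.
  by apply: eq_bigr => e _; rewrite /f eqb_id; case: ifP => // _; rewrite xi_sym.
rewrite lawE; apply: eq_integral => w _; rewrite idc mul1r big_imset//=; congr EFin.
by apply: eq_bigr => e _; rewrite /f; case: ifP => //= _; rewrite W_sym.
Qed.

Variables (V E : finType) (D : {set E}) (va vb : E -> V).
Hypothesis loopless : forall e, e \in D -> va e != vb e.
Hypothesis simple : {in D &, forall e e',
  (va e = va e' /\ vb e = vb e') \/ (va e = vb e' /\ vb e = va e') -> e = e'}.

Definition edges_in (t : V -> nat) (w : Omega) : R :=
  \prod_(e in D) (xi (t (va e)) (t (vb e)) w)%:R.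
Definition graph_weight (y : V -> R) : R := \prod_(e in D) W (y (va e)) (y (vb e)).

(** Constancy in [y] says that [L] lists every vertex on which the weight depends, so isolated
    vertices may be left out; [c] is then the density of the graph in [W]. *)
Variables (L : seq V) (c : R).
Hypothesis cE : forall y, cint L graph_weight y = c.

Lemma bmeas_edges_in t : bmeas (edges_in t).
Proof. by apply: bmeas_prod => e _; exact: bmeas_edge. Qed.

Lemma edges_in_bounds t w : 0 <= edges_in t w <= 1.
Proof.
by rewrite prodr_ge0 ?prodr_ile1// => e _; rewrite ?ler0n ?lern1 ?leq_b1.
Qed.

Lemma cmeas_graph_weight (I : finType) (t : V -> I) :
  cmeas (fun y : I -> R => graph_weight (fun v => y (t v))).
Proof.
by apply: bmeas_prod => e _; apply: bmeas_graphon; exact: measurable_coord.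
Qed.

Lemma density_bounds : 0 <= c <= 1.
Proof.
have [_ _ W01] := hW.
have gw01 y : 0 <= graph_weight y <= 1.
  by rewrite prodr_ge0 ?prodr_ile1// => e _; case/andP: (W01 (y (va e)) (y (vb e))).
have cm : cmeas graph_weight := cmeas_graph_weight id.
rewrite -(cE (fun=> 0)); apply/andP; split.
  rewrite -[leLHS](cint_cst L 0 (fun=> 0)); apply: le_cint => // [|y].
    exact: bmeas_cst.
  by case/andP: (gw01 y).
rewrite -[leRHS](cint_cst L 1 (fun=> 0)); apply: le_cint => // [|y].
  exact: bmeas_cst.
by case/andP: (gw01 y).
Qed.

(** An injective [t] sends distinct edges to distinct pairs, so the indicators may be replaced by
    values of [W]; integrating out the images of [L] then leaves [c]. *)
Lemma expectation_edges_in N (t : V -> 'I_N) : injective t ->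
  \int[P]_w edges_in t w = c.
Proof.
move=> tI; rewrite /edges_in.
rewrite (@edge_expectation E D N (t \o va) (t \o vb))/=; last 2 first.
- by move=> e eD; rewrite (inj_eq tI) loopless.
- move=> e e' eD e'D h; apply: simple => //.
  by case: h => -[/tI ? /tI ?]; [left|right].
transitivity (\int[P]_w graph_weight (fun v => sample X N w (t v))); first by [].
rewrite (sample_cint hX (map t L) (cmeas_graph_weight t)).
transitivity (\int[P]_w (cst c w)); last exact: expectation_cst.
by apply: eq_Rintegral => w _; rewrite (cint_reindex _ graph_weight).
Qed.

Lemma expectation_edges_in2 N (t : V + V -> 'I_N) : injective t ->
  \int[P]_w (edges_in (t \o inl) w * edges_in (t \o inr) w) = c * c.
Proof.
move=> tI.
pose a (be : bool * E) := t (if be.1 then inl (va be.2) else inr (va be.2)).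
pose b (be : bool * E) := t (if be.1 then inl (vb be.2) else inr (vb be.2)).
(* The two copies are treated as one graph with edges tagged by a boolean, so that the edge law is
   applied once to all their edges together. *)
pose D2 : {set bool * E} := [set be | be.2 \in D]%SET.
have prodD2 (f : bool * E -> R) :
    \prod_(be in D2) f be = \prod_(e in D) f (true, e) * \prod_(e in D) f (false, e).
  rewrite -(big_bool _ (fun x => \prod_(e in D) f (x, e))) pair_big_dep/=.
  by apply: eq_big => [[x e]|[x e] _] /=; rewrite ?inE.
transitivity (\int[P]_w \prod_(be in D2) (xi (a be) (b be) w)%:R).
  by apply: eq_Rintegral => w _; rewrite prodD2.
rewrite edge_expectation; last 2 first.
- by move=> [[] e]; rewrite inE/= => eD; rewrite (inj_eq tI)/=; have := loopless eD;
    apply: contra => /eqP[->].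
- move=> [x e] [x' e']; rewrite !inE /a /b /= => eD e'D.
  case: x; case: x' => h; try by case: h => -[/tI ? /tI ?].
    by congr pair; apply: simple => //; case: h => -[/tI[?] /tI[?]]; [left|right].
  by congr pair; apply: simple => //; case: h => -[/tI[?] /tI[?]]; [left|right].
transitivity (\int[P]_w (graph_weight (fun v => sample X N w (t (inr v))) *
                         graph_weight (fun v => sample X N w (t (inl v))))).
  by apply: eq_Rintegral => w _; rewrite prodD2 mulrC.
have cl := cmeas_graph_weight (t \o inl); have cr := cmeas_graph_weight (t \o inr).
(* Only the vertices of the left copy are integrated out. The right factor is constant for them and
   comes out, so the left copy contributes [c] and an expectation over a single copy remains. *)
rewrite (sample_cint hX (map (t \o inl) L) (bmeasM cr cl)).
transitivity (\int[P]_w (c * graph_weight (fun v => sample X N w (t (inr v))))).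
  apply: eq_Rintegral => w _; rewrite cintM_invariant//; last first.
    move=> i /mapP[v _ ->] y u; congr graph_weight; apply/funext => v'.
    by rewrite updE (inj_eq tI).
  rewrite (@cint_reindex R V _ (t \o inl) L graph_weight) ?cE 1?mulrC//.
  by move=> v v' /tI[].
rewrite expectationZ; last exact: (bmeas_sample hX cr).
congr (_ * _); rewrite -(@expectation_edges_in N (t \o inr)); last first.
  by move=> v v' /tI[].
rewrite /edges_in (@edge_expectation E D N (t \o inr \o va) (t \o inr \o vb))//=.
- by move=> e eD; rewrite (inj_eq tI); have := loopless eD; apply: contra => /eqP[->].
- by move=> e e' eD e'D h; apply: simple => //; case: h => -[/tI[?] /tI[?]]; [left|right].
Qed.

Definition hom_density n (w : Omega) : R :=
  avg [set: {ffun V -> 'I_n}] (fun t => edges_in (fun v => t v) w).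

Lemma bmeas_avg (T : finType) (A : {set T}) (f : T -> Omega -> R) :
  (forall a, bmeas (f a)) -> bmeas (fun w => avg A (fun a => f a w)).
Proof. by move=> bf; apply: bmeasZ; exact: bmeas_sum. Qed.

Lemma expectation_avg (T : finType) (A : {set T}) (f : T -> Omega -> R) :
  (forall a, bmeas (f a)) ->
  \int[P]_w avg A (fun a => f a w) = avg A (fun a => \int[P]_w f a w).
Proof.
move=> bf; rewrite /avg expectationZ; last exact: bmeas_sum.
by rewrite expectation_sum.
Qed.

Lemma bmeas_hom_density n : bmeas (hom_density n).
Proof. by apply: bmeas_avg => t; exact: bmeas_edges_in. Qed.

Lemma hom_density_variance n : (0 < n)%N ->
  \int[P]_w ((hom_density n w - c) * (hom_density n w - c)) <=
  (#|{: V + V}| ^ 2)%:R / n%:R.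
Proof.
move=> n0.
have nV : (0 < #|[set: {ffun V -> 'I_n}]%SET|)%N.
  by rewrite cardsT card_ffun card_ord expn_gt0 n0.
(* A pair of maps on [V] is one map on [V + V], injective exactly when both maps are and their
   images are disjoint; this is the case of zero covariance. *)
pose split (s : {ffun V + V -> 'I_n}) := ([ffun v => s (inl v)], [ffun v => s (inr v)]).
have split_bij : bijective split.
  exists (fun tt' : {ffun V -> 'I_n} * {ffun V -> 'I_n} =>
      [ffun v => match v with inl v => tt'.1 v | inr v => tt'.2 v end]).
    by move=> s; apply/ffunP => -[v|v]; rewrite !ffunE.
  by move=> [t t']; congr pair; apply/ffunP => v; rewrite !ffunE.
pose g (s : V + V -> 'I_n) w :=
  (edges_in (s \o inl) w - c) * (edges_in (s \o inr) w - c).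
have bg s : bmeas (g s).
  by apply: bmeasM; apply: bmeasB; try exact: bmeas_edges_in; exact: bmeas_cst.
have -> : \int[P]_w ((hom_density n w - c) * (hom_density n w - c)) =
    \int[P]_w avg [set: {ffun V + V -> 'I_n}] (fun s => g s w).
  apply: eq_Rintegral => w _.
  have hE : hom_density n w - c =
      avg [set: {ffun V -> 'I_n}] (fun t => edges_in (fun v => t v) w - c).
    by rewrite avgB avg_cst.
  transitivity (avg [set: {ffun V -> 'I_n} * {ffun V -> 'I_n}] (fun tt' =>
      (edges_in (fun v => tt'.1 v) w - c) * (edges_in (fun v => tt'.2 v) w - c))).
    rewrite -(avg_pair (fun t t' : {ffun V -> 'I_n} =>
      (edges_in (fun v => t v) w - c) * (edges_in (fun v => t' v) w - c))).
    rewrite {1}hE /avg -mulrA; congr (_ * _); rewrite mulr_suml.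
    by apply: eq_bigr => t _; rewrite hE /avg mulrCA mulr_sumr.
  rewrite -(avg_bij _ split_bij); apply: eq_avg => s _; rewrite /g.
  by congr ((_ - _) * (_ - _)); congr edges_in; apply/funext => v; rewrite /= ffunE.
rewrite expectation_avg//; apply: le_trans (avg_noninjective_ffun R _ n0).
apply: le_avg => s _.
have [c0 c1] := andP density_bounds.
have [/injectiveP sI|_] /= := boolP (injectiveb s); last first.
  rewrite -[leRHS](expectation_cst P 1); apply: le_expectation => // [|w].
    exact: bmeas_cst.
  have := edges_in_bounds (s \o inl) w; have := edges_in_bounds (s \o inr) w.
  rewrite /g /cst.
  move: (edges_in (s \o inr) w) (edges_in (s \o inl) w) => x y.
  move=> /andP[x0 x1] /andP[y0 y1].
  (* With a = x - c and b = y - c in [-1,1], the products (1 - a)(1 + b) and (1 + a)(1 - b) add up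
     to 2 - 2ab, whence ab is at most 1. *)
  have h1 : 0 <= (1 - (x - c)) * (1 + (y - c)) by apply: mulr_ge0; lra.
  have h2 : 0 <= (1 + (x - c)) * (1 - (y - c)) by apply: mulr_ge0; lra.
  lra.
have bi t : bmeas (edges_in t) := bmeas_edges_in t.
have sIl : injective (s \o inl) by move=> v v' /sI[].
have sIr : injective (s \o inr) by move=> v v' /sI[].
rewrite (_ : \int[P]_w g s w = 0)//.
transitivity (\int[P]_w (edges_in (s \o inl) w * edges_in (s \o inr) w +
   ((- c) * edges_in (s \o inl) w + ((- c) * edges_in (s \o inr) w + c * c)))).
  by apply: eq_Rintegral => w _; rewrite /g; ring.
rewrite expectationD; [|exact: bmeasM|]; last first.
  apply: bmeasD; first exact: bmeasZ.
  by apply: bmeasD; [exact: bmeasZ|exact: bmeas_cst].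
rewrite expectationD; [|exact: bmeasZ|]; last first.
  by apply: bmeasD; [exact: bmeasZ|exact: bmeas_cst].
rewrite expectationD; [|exact: bmeasZ|exact: bmeas_cst].
rewrite [X in _ + (_ + (_ + X))](expectation_cst P (c * c)) !expectationZ//.
rewrite expectation_edges_in2// !expectation_edges_in//.
ring.
Qed.

End random_graph.

(** * Almost sure convergence from summable expectations *)

Section almost_sure.
Context (R : realType) (dO : measure_display) (Omega : measurableType dO).
Variable (P : probability Omega R).

(** By monotone convergence the series of the [Z n] has expectation at most [K]; it is therefore
    finite almost everywhere, and the terms of a convergent series tend to 0. *)
Lemma ae_cvg0_of_summable_expectation (Z : nat -> Omega -> R) (K : R) :
  (forall n, bmeas (Z n)) -> (forall n w, 0 <= Z n w) ->
  (forall N, \sum_(0 <= n < N) \int[P]_w Z n w <= K) ->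
  {ae P, forall w, Z n w @[n --> \oo] --> 0}.
Proof.
move=> bZ Z0 ZK.
have mZ n : measurable_fun setT (fun w => (Z n w)%:E).
  by apply/measurable_EFinP; case: (bZ n).
have Z0E n w : setT w -> (0 <= (Z n w)%:E)%E by rewrite lee_fin.
pose S w := (\sum_(0 <= n <oo) (Z n w)%:E)%E.
have S0 w : (0 <= S w)%E by apply: nneseries_ge0 => n _ _; exact: Z0E.
have intS : (\int[P]_w S w <= K%:E)%E.
  rewrite integral_nneseries//.
  apply: lime_le.
    by apply: is_cvg_nneseries => n _ _; apply: integral_ge0 => w _; exact: Z0E.
  apply: nearW => N; apply: le_trans (_ : (\sum_(0 <= n < N) \int[P]_w Z n w)%:E <= _)%E.
    rewrite -sumEFin; apply: lee_sum => n _.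
    by rewrite fineK//; exact: (integrable_fin_num measurableT (bmeas_integrableT P (bZ n))).
  by rewrite lee_fin.
have iS : P.-integrable setT S.
  apply/integrableP; split.
    by apply: ge0_emeasurable_sum => // n w _ _; exact: Z0E.
  rewrite (eq_integral S) => [|w _]; last by rewrite gee0_abs.
  exact: le_lt_trans intS (ltry _).
apply: filterS (integrable_ae measurableT iS) => w /(_ I) Sw.
apply: cvg_series_cvg_0; apply: nondecreasing_is_cvgn.
  apply: nondecreasing_series => n _ _; exact: Z0.
exists (fine (S w)) => _ [N _ <-].
rewrite -lee_fin fineK// /series/= -sumEFin.
by apply: nneseries_lim_ge => n _ _; exact: Z0E.
Qed.

End almost_sure.

(** * From convergence along squares to convergence along all integers *)

Section square_interpolation.
Variable R : realType.

Lemma sqrt_bracket n : (0 < n)%N -> exists j, (j.+1 ^ 2 <= n < j.+2 ^ 2)%N.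
Proof.
elim: n => // n IH _; have [->|n0] := posnP n; first by exists 0%N.
have [j /andP[jn nj]] := IH n0.
have [n1|n1] := ltnP n.+1 (j.+2 ^ 2)%N; first by exists j; rewrite n1 ltnW.
exists j.+1; rewrite n1/=; apply: leq_ltn_trans nj _.
by rewrite ltn_exp2r.
Qed.

Lemma cvg_ratio (v : nat) : (j.+1%:R / j.+2%:R) ^+ v @[j --> \oo] --> (1 : R).
Proof.
have h : (j.+1%:R / j.+2%:R : R) @[j --> \oo] --> (1 : R).
  rewrite (_ : (fun j => _) = (fun j => 1 - (harmonic j.+1 : R))).
    rewrite -[X in _ --> X]subr0; apply: cvgB; first exact: cvg_cst.
    by have := @cvg_harmonic R; rewrite -(cvg_shiftS (@harmonic R : nat -> R)).
  apply/funext => j /=; apply: (mulIf (_ : j.+2%:R != 0)); first by rewrite pnatr_eq0.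
  by rewrite mulrBl mul1r mulVf ?pnatr_eq0// divfK ?pnatr_eq0// -[j.+2%:R]natr1 addrK.
elim: v => [|v IH].
  rewrite (_ : (fun j => _) = (fun=> 1)); first exact: cvg_cst.
  by apply/funext => j; rewrite expr0.
rewrite (_ : (fun j => _) = (fun j => j.+1%:R / j.+2%:R * (j.+1%:R / j.+2%:R : R) ^+ v)).
  by rewrite -[X in _ --> X]mulr1; apply: cvgM.
by apply/funext => j; rewrite exprS.
Qed.

(** Between consecutive squares, numerator and denominator are both monotone. The quotient is thus
    trapped between its values at the two squares, corrected by [rho j], the ratio of the two
    denominators, which tends to 1. *)
Lemma cvg_of_squares (S : nat -> R) (v : nat) (c : R) :
  (forall n, 0 <= S n) -> (forall n m, (n <= m)%N -> S n <= S m) ->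
  S (j.+1 ^ 2)%N / (j.+1 ^ 2)%:R ^+ v @[j --> \oo] --> c ->
  S n / n%:R ^+ v @[n --> \oo] --> c.
Proof.
move=> S0 Smono hc.
pose h j := S (j.+1 ^ 2)%N / (j.+1 ^ 2)%:R ^+ v.
pose rho j : R := (j.+1%:R / j.+2%:R) ^+ (2 * v).
have lo : h j * rho j @[j --> \oo] --> c.
  by rewrite -[X in _ --> X]mulr1; apply: cvgM => //; exact: cvg_ratio.
have up : h j.+1 / rho j @[j --> \oo] --> c.
  have cE : c * 1^-1 = c by rewrite invr1 mulr1.
  rewrite -[X in _ --> X]cE; apply: cvgM.
    by move: hc; rewrite -(cvg_shiftS h).
  by apply: cvgV; [exact: oner_neq0|exact: cvg_ratio].
have bracket n j : (j.+1 ^ 2 <= n < j.+2 ^ 2)%N ->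
    h j * rho j <= S n / n%:R ^+ v <= h j.+1 / rho j.
  move=> /andP[jn nj]; have n0 : (0 < n)%N by apply: leq_trans jn.
  have pos m : 0 < (m.+1 ^ 2)%:R ^+ v :> R by rewrite exprn_gt0// ltr0n expn_gt0.
  have n0' : 0 < n%:R ^+ v :> R by rewrite exprn_gt0// ltr0n.
  have rhoE : rho j = (j.+1 ^ 2)%:R ^+ v / (j.+2 ^ 2)%:R ^+ v.
    by rewrite /rho exprM -!exprVn -exprMn !natrX expr_div_n.
  apply/andP; split.
    rewrite rhoE /h mulrA divfK ?gt_eqF//; apply: ler_pM => //.
    - exact: Smono.
    - by rewrite lef_pV2 ?posrE// lerXn2r ?nnegrE// ler_nat ltnW.
  rewrite rhoE /h invf_div mulrA divfK ?gt_eqF//; apply: ler_pM => //.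
  - by apply: Smono; exact: ltnW.
  - by rewrite lef_pV2 ?posrE// lerXn2r ?nnegrE// ler_nat.
apply/cvgrPdist_le => e e0.
move/cvgrPdist_le : lo => /(_ e e0) [J1 _ lo].
move/cvgrPdist_le : up => /(_ e e0) [J2 _ up].
(* Beyond this threshold the bracketing index [j] is at least both [J1] and [J2]. *)
exists ((maxn J1 J2).+1 ^ 2)%N => // n /= Jn.
have [|j jn] := @sqrt_bracket n; first by apply: leq_trans Jn; rewrite expn_gt0.
have Jj : (maxn J1 J2 <= j)%N.
  rewrite leqNgt; apply/negP => jJ; move/andP: jn => [_]; rewrite ltnNge => /negP; apply.
  by apply: leq_trans Jn; rewrite leq_exp2r.
have := bracket n j jn; have := lo j (leq_trans (leq_maxl _ _) Jj).
have := up j (leq_trans (leq_maxr _ _) Jj).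
rewrite /= !ler_distlC => /andP[u1 u2] /andP[l1 l2] /andP[b1 b2].
by apply/andP; split; lra.
Qed.

Lemma sum_inv_squares_le N : \sum_(0 <= j < N) (j.+1 ^ 2)%:R^-1 <= 2 :> R.
Proof.
(* This sharper form passes the induction: with a = N + 1, the new term 1/a^2 is at most 2/a - 2/(a
   + 1), which equals 2/(a(a + 1)), because a + 1 is at most 2a. *)
suff : \sum_(0 <= j < N) (j.+1 ^ 2)%:R^-1 <= 2 - 2 / N.+1%:R :> R.
  by move/le_trans; apply; rewrite gerBl divr_ge0.
elim: N => [|N IH]; first by rewrite big_nil divr1 subrr.
rewrite big_nat_recr//=; apply: (le_trans (lerD IH (lexx _))).
have a1 : 1 <= N.+1%:R :> R by rewrite ler1n.
rewrite natrX -[N.+2%:R]natr1; move: N.+1%:R a1 => a a1.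
have a0 : 0 < a by lra.
have -> : 2 - 2 / (a + 1) = 2 - 2 / a + 2 / (a * (a + 1)).
  by field; apply/andP; split; apply: lt0r_neq0; lra.
rewrite lerD2l -(ler_pM2r (_ : 0 < a ^+ 2 * (a + 1))); last first.
  by rewrite mulr_gt0 ?exprn_gt0//; lra.
have -> : a ^- 2 * (a ^+ 2 * (a + 1)) = a + 1 by field; exact: lt0r_neq0.
have -> : 2 / (a * (a + 1)) * (a ^+ 2 * (a + 1)) = 2 * a.
  by field; apply/andP; split; apply: lt0r_neq0; lra.
lra.
Qed.

End square_interpolation.

(** * Almost sure convergence of homomorphism densities *)

Section density_convergence.
Context (R : realType) (dO : measure_display) (Omega : measurableType dO).
Variables (P : probability Omega R) (W : R -> R -> R) (X : nat -> Omega -> R).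
Variable xi : nat -> nat -> Omega -> bool.
Hypotheses (hW : graphon W) (hX : iid_uniform P X) (hxi : edge_law P W X xi).
Variables (V E : finType) (D : {set E}) (va vb : E -> V).
Hypothesis loopless : forall e, e \in D -> va e != vb e.
Hypothesis simple : {in D &, forall e e',
  (va e = va e' /\ vb e = vb e') \/ (va e = vb e' /\ vb e = va e') -> e = e'}.
Variables (L : seq V) (c : R).
Hypothesis cE : forall y, cint L (graph_weight W D va vb) y = c.

Let Y n w : R := \sum_(t : {ffun V -> 'I_n}) edges_in R xi D va vb (fun v => t v) w.

Let hom_densityE n w : hom_density R xi D va vb n w = Y n w / n%:R ^+ #|V|.
Proof.
rewrite /hom_density /avg cardsT card_ffun card_ord natrX mulrC; congr (_ * _).
by apply: eq_bigl => t; rewrite inE.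
Qed.

(** All the graphs share the same indicators [xi], so a map into the first [n] vertices keeps its
    weight when read as a map into the first [m]; the additional terms are nonnegative. *)
Let Y_mono w n m : (n <= m)%N -> Y n w <= Y m w.
Proof.
move=> nm.
pose f (t : {ffun V -> 'I_n}) : {ffun V -> 'I_m} := [ffun v => widen_ord nm (t v)].
have fI : injective f.
  move=> t t' /ffunP ff; apply/ffunP => v; have := ff v; rewrite !ffunE.
  by move/(congr1 val) => /= /val_inj.
rewrite /Y [leRHS](bigID (mem (f @: [set: {ffun V -> 'I_n}]%SET)))/=.
rewrite ler_wpDr//.
  by apply: sumr_ge0 => t _; case/andP: (edges_in_bounds R xi D va vb (fun v => t v) w).
rewrite (eq_bigl (mem (f @: [set: {ffun V -> 'I_n}]%SET)))// big_imset/=; last first.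
  by move=> ? ? _ _; exact: fI.
rewrite [leRHS](eq_bigl xpredT) => [|t]; last by rewrite inE.
rewrite le_eqVlt; apply/orP; left; apply/eqP; apply: eq_bigr => t _.
by congr edges_in; apply/funext => v; rewrite ffunE.
Qed.

Lemma hom_density_cvg :
  {ae P, forall w, hom_density R xi D va vb n w @[n --> \oo] --> c}.
Proof.
have bh n := bmeas_hom_density hxi D va vb n.
pose Z j w := (hom_density R xi D va vb (j.+1 ^ 2) w - c) *
              (hom_density R xi D va vb (j.+1 ^ 2) w - c).
have bZ j : bmeas (Z j).
  by apply: bmeasM; apply: bmeasB; (exact: bh || exact: bmeas_cst).
have Z0 j w : 0 <= Z j w by rewrite /Z -expr2 sqr_ge0.
have := @ae_cvg0_of_summable_expectation _ _ _ P Z ((#|{: V + V}| ^ 2)%:R * 2) bZ Z0.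
have sumZ N : \sum_(0 <= n < N) \int[P]_w Z n w <= (#|{: V + V}| ^ 2)%:R * 2.
  apply: (@le_trans _ _ ((#|{: V + V}| ^ 2)%:R * \sum_(0 <= j < N) (j.+1 ^ 2)%:R^-1)).
    rewrite mulr_sumr; apply: ler_sum => j _.
    by apply: (hom_density_variance hW hX hxi loopless simple cE); rewrite expn_gt0.
  by rewrite ler_wpM2l// sum_inv_squares_le.
move=> /(_ sumZ); apply: filterS => w Zw.
rewrite (_ : (fun n => _) = (fun n => Y n w / n%:R ^+ #|V|)); last first.
  by apply/funext => n; exact: hom_densityE.
apply: cvg_of_squares => [n|n m|].
- by apply: sumr_ge0 => t _; case/andP: (edges_in_bounds R xi D va vb (fun v => t v) w).
- exact: Y_mono.
apply/cvgrPdist_le => e e0; have e20 : 0 < e * e by rewrite mulr_gt0.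
move/cvgrPdist_le : Zw => /(_ _ e20); apply: filterS => j.
rewrite sub0r normrN /Z normrM -expr2 => h.
by rewrite distrC -hom_densityE -ler_sqr ?nnegrE ?normr_ge0 ?(ltW e0)//.
Qed.

End density_convergence.

(** * The glued graph and the moments *)

Section glued_graph.
Variables (R : realType) (d p k r : nat) (W : R -> R -> R).
Hypothesis hW : graphon W.
Variables (F : 'I_d -> rel 'I_p) (l : 'I_k -> 'I_p).
Hypothesis hF : forall m, simple_graph (F m).
Hypotheses (hl : injective l) (hcomp : compatible F l).
Variable m : 'I_r.+1 -> 'I_d.

(* Edges between labelled vertices are common to all the copies; they are
   counted in copy 0 only. *)
Definition glued_edges : {set 'I_r.+1 * ('I_p * 'I_p)} :=
  [set e : 'I_r.+1 * ('I_p * 'I_p) | [&& (e.2.1 < e.2.2)%N, F (m e.1) e.2.1 e.2.2 &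
               Elab F l e.2.1 e.2.2 ==> (e.1 == ord0)]]%SET.
Definition src (e : 'I_r.+1 * ('I_p * 'I_p)) : glued p k r.+1 := vtx l e.1 e.2.1.
Definition tgt (e : 'I_r.+1 * ('I_p * 'I_p)) : glued p k r.+1 := vtx l e.1 e.2.2.

(** Forgetting the copy is a common left inverse of all the maps [vtx l s]. *)
Let unglue (v : glued p k r.+1) : 'I_p :=
  match v with inl i => l i | inr sq => sq.2 end.

Let vtxK s : cancel (vtx l s) unglue.
Proof. by move=> q; rewrite /vtx; case: overP. Qed.

Lemma vtx_inj (s : 'I_r.+1) : injective (vtx l s).
Proof. exact: can_inj (vtxK s). Qed.

Lemma ElabE (s : 'I_r.+1) i j : labelled l i -> labelled l j -> (i < j)%N ->
  F (m s) i j -> Elab F l i j.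
Proof.
move=> li lj ij Fij; rewrite /Elab ij li lj /=.
by apply/forallP => m'; rewrite (hcomp m' (m s)).
Qed.

Lemma glued_loopless e : e \in glued_edges -> src e != tgt e.
Proof.
rewrite inE => /and3P[ij _ _]; apply: contraTneq ij => /vtx_inj ->.
by rewrite ltnn.
Qed.

(** Forgetting the copies shows that both edges come from the same pair of vertices, the order of
    the endpoints excluding a swap. If the pair is a labelled edge, both lie in copy 0; otherwise
    compatibility provides an unlabelled endpoint, whose glued vertex remembers its copy. *)
Lemma glued_simple : {in glued_edges &, forall e e',
  (src e = src e' /\ tgt e = tgt e') \/ (src e = tgt e' /\ tgt e = src e') -> e = e'}.
Proof.
move=> [s [i j]] [s' [i' j']]; rewrite !inE/= => /and3P[ij Fij E0] /and3P[ij' Fij' E0'].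
rewrite /src /tgt /= => h.
have [ii jj] : i = i' /\ j = j'.
  case: h => -[/(congr1 unglue) + /(congr1 unglue)]; rewrite !vtxK//.
  by move=> ii jj; rewrite ii jj ltnNge (ltnW ij') in ij.
subst i' j'; congr pair.
have [Eij|NE] := boolP (Elab F l i j).
  by move: E0 E0'; rewrite Eij /= => /eqP-> /eqP->.
have vtx_unl q : ~~ labelled l q -> forall u : 'I_r.+1, vtx l u q = inr (u, q).
  by move=> qN u; rewrite /vtx; move: qN; case: overP.
have [h1 h2] : vtx l s i = vtx l s' i /\ vtx l s j = vtx l s' j.
  case: h => //; case=> /(congr1 unglue); rewrite !vtxK => iEj.
  by rewrite iEj ltnn in ij.
have [iL|iN] := boolP (labelled l i); last by move: h1; rewrite !vtx_unl// => -[].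
have [jL|jN] := boolP (labelled l j); last by move: h2; rewrite !vtx_unl// => -[].
by rewrite (ElabE iL jL ij Fij) in NE.
Qed.

Lemma edges_in_glued dO (Omega : measurableType dO) (xi : nat -> nat -> Omega -> bool) w n
    (t : glued p k r.+1 -> 'I_n) :
  (forall i j, xi i j w = xi j i w) ->
  edges_in R xi glued_edges src tgt (fun v => t v) w =
  (glued_hom F l m (fun i j => xi i j w) t)%:R.
Proof.
move=> xi_sym; rewrite /edges_in.
have -> : glued_hom F l m (fun i j => xi i j w) t =
    [forall e, (e \in glued_edges) ==> xi (t (src e)) (t (tgt e)) w].
  apply/idP/idP => [/forallP h|/forallP h].
    apply/forallP => -[s [i j]]; apply/implyP; rewrite inE/= => /and3P[ij Fij _].
    by have /forallP/(_ i)/forallP/(_ j) := h s; rewrite Fij.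
  apply/forallP => s; apply/forallP => i; apply/forallP => j; apply/implyP => Fij.
  have [F_sym F_irr] := hF (m s).
  wlog ij : i j Fij / (i < j)%N => [wh|].
    case: (ltngtP i j) => [ij|ji|/val_inj ij]; first exact: wh.
      by rewrite xi_sym; apply: wh => //; rewrite F_sym.
    by rewrite ij F_irr in Fij.
  (* An edge between labels is represented in copy 0: compatibility makes it an edge there too, and
     both copies place it on the same glued vertices. *)
  pose s' := if Elab F l i j then ord0 else s.
  have := h (s', (i, j)); rewrite inE/= ij /= => /implyP; rewrite /src /tgt /=.
  have -> : F (m s') i j.
    rewrite /s'; case: ifP => // /and4P[_ iL jL _].
    by rewrite (hcomp _ (m s)).
  have -> : Elab F l i j ==> (s' == ord0).
    by rewrite /s'; case: ifP.
  move=> /(_ isT); rewrite /s'; case: ifP => // /and4P[_ iL jL _].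
  rewrite /vtx; move: iL jL; case: (overP l inl (fun q => inr (ord0, q)) i) => // a ai _.
  case: (overP l inl (fun q => inr (ord0, q)) j) => // b bj _.
  by rewrite -ai -bj !(over_label hl).
rewrite natr_forall big_mkcond/=; apply: eq_bigr => e _.
by case: (e \in _).
Qed.

Definition rest_weight (m' : 'I_d) (z : 'I_p -> R) : R :=
  \prod_(i : 'I_p) \prod_(j : 'I_p | [&& (i < j)%N, F m' i j & ~~ Elab F l i j])
    W (z i) (z j).

Definition unlabelled : seq 'I_p := [seq q <- enum 'I_p | ~~ labelled l q].

Lemma ttilde_xE x m' : ttilde_x W F l x m' = cint unlabelled (rest_weight m') (lab l x).
Proof. by []. Qed.

(** Labelled edges occur in copy 0 only and produce the single factor [that_x]; the remaining edges
    of each copy produce its [rest_weight]. *)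
Lemma glued_weightE (y : glued p k r.+1 -> R) :
  graph_weight W glued_edges src tgt y =
  that_x W F l (fun i => y (inl i)) *
  \prod_(s <- enum 'I_r.+1) rest_weight (m s) (fun q => y (vtx l s q)).
Proof.
rewrite big_enum/=.
pose P (s : 'I_r.+1) (i j : 'I_p) :=
  [&& (i < j)%N, F (m s) i j & Elab F l i j ==> (s == ord0)].
pose G (s : 'I_r.+1) (i j : 'I_p) : R := W (y (vtx l s i)) (y (vtx l s j)).
have -> : graph_weight W glued_edges src tgt y =
    \prod_s \prod_i \prod_(j | P s i j) G s i j.
  under [RHS]eq_bigr do rewrite pair_big_dep/=.
  rewrite pair_big_dep/= /graph_weight.
  by apply: eq_big => [[s [i j]]|[s [i j]] _] //=; rewrite inE.
have -> : that_x W F l (fun i => y (inl i)) =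
    \prod_s \prod_i \prod_(j | P s i j && Elab F l i j) G s i j.
  rewrite (bigD1 ord0)//= [X in _ * X]big1 ?mulr1; last first.
    move=> s s0; rewrite big1// => i _; rewrite big_pred0// => j.
    by rewrite /P; case: (Elab F l i j) => /=; rewrite ?(negbTE s0) ?andbF.
  apply: eq_bigr => i _; apply: eq_big => [j|j Eij].
    rewrite /P eqxx implybT andbT; case: (boolP (Elab F l i j)); rewrite ?andbF//.
    by move=> /and4P[-> _ _ /forallP ->].
  have /and4P[_ iL jL _] := Eij.
  rewrite /G /vtx; move: iL jL.
  case: (overP l inl (fun q => inr (ord0, q)) i) => // a ai _.
  case: (overP l inl (fun q => inr (ord0, q)) j) => // b bj _.
  by rewrite -ai -bj /lab -!/(over l _ (fun=> 0) _) !(over_label hl).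
rewrite -big_split/=; apply: eq_bigr => s _.
rewrite -big_split/=; apply: eq_bigr => i _.
rewrite [LHS](bigID (fun j => Elab F l i j))/=; congr (_ * _).
apply: eq_bigl => j; rewrite /P; case: (Elab F l i j) => /=; rewrite ?andbF ?andbT//.
Qed.

Lemma measurable_lab_coord q : measurable_fun setT (fun x : coords R 'I_k => lab l x q).
Proof.
rewrite /lab; case: pickP => [i _|_]; first exact: measurable_coord.
exact: measurable_cst.
Qed.

Lemma measurable_lab : measurable_fun setT (fun x : coords R 'I_k => lab l x : coords R 'I_p).
Proof. by apply: measurable_coords => q; exact: measurable_lab_coord. Qed.

Lemma cmeas_that : cmeas (that_x W F l : ('I_k -> R) -> R).
Proof.
by apply: bmeas_prod => i _; apply: bmeas_prod => j _; apply: (bmeas_graphon hW);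
  exact: measurable_lab_coord.
Qed.

Lemma cmeas_rest m' : cmeas (rest_weight m').
Proof.
by apply: bmeas_prod => i _; apply: bmeas_prod => j _; apply: (bmeas_graphon hW);
  exact: measurable_coord.
Qed.

Lemma cmeas_ttilde m' : cmeas (fun x : 'I_k -> R => ttilde_x W F l x m').
Proof.
exact: (bmeas_comp measurable_lab (cmeas_cint unlabelled (cmeas_rest m'))).
Qed.

Definition glued_density : R :=
  cube_int (fun x => that_x W F l x * \prod_(s < r.+1) ttilde_x W F l x (m s)).

(** With the labels outermost, the inner integrals are taken at fixed labels and no exchange of
    integrals is required. The isolated vertices [inr (s, l i)] are left out. *)
Definition glued_order : seq (glued p k r.+1) :=
  map inl (enum 'I_k) ++ flatten [seq map (vtx l s) unlabelled | s <- enum 'I_r.+1].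

(** At fixed labels, distinct copies share no integrated vertex, so the inner integral factors into
    the [ttilde_x]; the outer one over the labels is then [glued_density]. *)
Lemma cint_glued_weight y :
  cint glued_order (graph_weight W glued_edges src tgt) y = glued_density.
Proof.
rewrite /glued_order cint_cat.
have -> : graph_weight W glued_edges src tgt = (fun y => that_x W F l (fun i => y (inl i)) *
  \prod_(s <- enum 'I_r.+1) rest_weight (m s) (fun q => y (vtx l s q))).
  by apply/funext => z; rewrite glued_weightE.
have unl s v : v \in [seq vtx l s i | i <- unlabelled] ->
    exists2 q, q \in unlabelled & v = inr (s, q).
  case/mapP => q qU ->; exists q => //.
  by move: qU; rewrite mem_filter /vtx => /andP[+ _]; case: overP.
have -> : cint (flatten [seq map (vtx l s) unlabelled | s <- enum 'I_r.+1])
    (fun y => that_x W F l (fun i => y (inl i)) *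
      \prod_(s <- enum 'I_r.+1) rest_weight (m s) (fun q => y (vtx l s q))) =
    (fun y => that_x W F l (fun i => y (inl i)) *
      \prod_(s < r.+1) ttilde_x W F l (fun i => y (inl i)) (m s)).
  apply/funext => z.
  rewrite (cint_blocks (L := fun s => map (vtx l s) unlabelled)
    (a := fun y => that_x W F l (fun i => y (inl i)))
    (F := fun s y => rest_weight (m s) (fun q => y (vtx l s q)))).
  - rewrite big_enum/=; congr (_ * _); apply: eq_bigr => s _.
    rewrite (@cint_reindex R _ _ (vtx l s) _ (rest_weight (m s))); last exact: vtx_inj.
    rewrite ttilde_xE; apply: eq_cint_point => q.
    rewrite mem_filter mem_enum andbT negbK => qL.
    rewrite /lab -/(over l _ (fun=> 0) q) /vtx; move: qL.
    by case: (overP l inl (fun q => inr (s, q)) q) => // i <- _; rewrite (over_label hl).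
  - exact: enum_uniq.
  - exact: (bmeas_comp (@measurable_reindex R _ _ inl) cmeas_that).
  - move=> s; exact: (bmeas_comp (@measurable_reindex R _ _ (vtx l s)) (cmeas_rest (m s))).
  - by move=> s v /unl[q _ ->] x t.
  - move=> s s' v ss' /unl[q _ ->] x t; congr rest_weight; apply/funext => q'.
    rewrite /= updE /vtx; case: overP => // _.
    by case: eqP => // -[s's _]; rewrite s's eqxx in ss'.
  - move=> s s' v ss' /unl[q _ ->]; apply/negP => /unl[q' _ [ss _]].
    by rewrite ss eqxx in ss'.
rewrite (@cint_reindex R _ _ inl _ (fun x => that_x W F l x *
   \prod_(s < r.+1) ttilde_x W F l x (m s))); last by move=> ? ? [].
by apply: eq_cint_point => i; rewrite mem_enum.
Qed.

End glued_graph.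

(** * Bernstein polynomials on the cube *)

Section bernstein.
Variables (R : realType) (d : nat).

Lemma cube_compact : compact (@cube R d).
Proof.
rewrite (_ : @cube R d = [set v : 'rV[R]_d | forall i, `[0%R, 1%R]%classic (v ord0 i)]).
  by apply: (@rV_compact R d (fun=> `[0%R, 1%R]%classic)) => i; exact: segment_compact.
by apply/seteqP; split => v /= h i; have := h i; rewrite in_itv.
Qed.

Lemma cube_near (g : 'rV[R]_d -> R) (v : 'rV[R]_d) (e : R) :
  {within @cube R d, continuous g} -> cube v -> 0 < e ->
  exists2 r, 0 < r & forall u, cube u -> (forall i, `|v ord0 i - u ord0 i| < r) ->
    `|g v - g u| < e.
Proof.
move=> /subspace_continuousP/(_ v) + cv e0 => /(_ cv)/cvgrPdist_lt/(_ e e0).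
rewrite near_withinE => /nbhs_ballP[r /= r0 h].
exists r => // u cu vu; apply: h => //; split=> // i j; rewrite (ord1 i).
exact: vu.
Qed.

Lemma nbhs_box (v : 'rV[R]_d) (r : R) : 0 < r ->
  \forall u \near v, forall i, `|v ord0 i - (u : 'rV[R]_d) ord0 i| < r.
Proof. by move=> r0; apply/nbhs_ballP; exists r => // u [_ vu] i; apply: vu. Qed.

Lemma cube_bounded (g : 'rV[R]_d -> R) : {within @cube R d, continuous g} ->
  exists M, forall v, cube v -> `|g v| <= M.
Proof.
move=> cg.
have /compact_near_coveringP/(_ nat \oo (fun n v => cube v -> `|g v| <= n%:R) _) :=
  cube_compact.
case=> [v cv|N _ /(_ N (leqnn N)) hN]; last by exists N%:R => v cv; exact: hN.
have [r r0 h] := cube_near cg cv ltr01.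
near=> u n => cu.
have gvn : `|g v| + 1 <= n%:R by near: n; exact: nbhs_infty_ger.
have vu i : `|v ord0 i - u ord0 i| < r by move: i; near: u; exact: nbhs_box.
have gvu := h u cu vu.
have -> : g u = g v - (g v - g u) by rewrite subKr.
by rewrite (le_trans (ler_normB _ _))// (le_trans _ gvn)// lerD2l ltW.
Unshelve. all: by end_near. Qed.

Lemma cube_uniform_continuity (g : 'rV[R]_d -> R) (e : R) : 0 < e ->
  {within @cube R d, continuous g} ->
  exists2 r, 0 < r & forall u v, cube u -> cube v ->
    (forall i, `|v ord0 i - u ord0 i| < r) -> `|g v - g u| <= e.
Proof.
move=> e0 cg; have e20 : 0 < e / 2 by rewrite divr_gt0.
have /compact_near_coveringP/(_ nat \oo (fun n v => cube v -> forall u, cube u ->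
    (forall i, `|v ord0 i - u ord0 i| < n.+1%:R^-1) -> `|g v - g u| <= e) _) :=
  cube_compact.
case=> [v cv|N _ /(_ N (leqnn N)) hN]; last first.
  exists N.+1%:R^-1; first by rewrite invr_gt0.
  by move=> u v cu cv; exact: hN.
have [r r0 h] := cube_near cg cv e20.
(* If [w] is within [r / 2] of the centre [v] and [u] within [r / 2] of [w], then both lie where [g]
   differs from [g v] by less than [e / 2]. *)
have r20 : 0 < r / 2 by rewrite divr_gt0.
near=> w n => cw u cu wu.
have vw i : `|v ord0 i - w ord0 i| < r / 2.
  by move: i; near: w; exact: nbhs_box.
have nr : n.+1%:R^-1 < r / 2 by near: n; exact: near_infty_natSinv_lt (PosNum r20).
have gvw : `|g v - g w| < e / 2.
  by apply: h => // i; apply: lt_trans (vw i) _; rewrite ltr_pdivrMr// ltr_pMr// ltr1n.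
have gvu : `|g v - g u| < e / 2.
  apply: h => // i; rewrite (splitr r) (le_lt_trans (ler_distD (w ord0 i) _ _))//.
  by rewrite ltrD// (lt_trans (wu i)).
rewrite (le_trans (ler_distD (g v) _ _))// (splitr e) lerD// ltW//.
by rewrite distrC.
Unshelve. all: by end_near. Qed.

Variable N : nat.
Implicit Types (t : {ffun 'I_d * 'I_N -> bool}) (v : 'rV[R]_d).

Definition coin (x : R) (b : bool) : R := if b then x else 1 - x.
(** The probability of the outcome [t] when each of d coins is tossed [N] times independently, coin
    i showing heads with probability [v ord0 i]; for fixed [t] it is a polynomial in [v]. *)
Definition coins t v : R := \prod_(e : 'I_d * 'I_N) coin (v ord0 e.1) (t e).
Definition frequency t : 'rV[R]_d := \row_i (N%:R^-1 * \sum_(s < N) (t (i, s))%:R).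
(** The multivariate Bernstein polynomial as the mean of [g] at the observed frequencies. Summing
    over outcomes rather than over counts of heads keeps binomial coefficients away. *)
Definition bernstein (g : 'rV[R]_d -> R) v : R :=
  \sum_(t : {ffun 'I_d * 'I_N -> bool}) g (frequency t) * coins t v.

Lemma coins_ge0 t v : cube v -> 0 <= coins t v.
Proof.
move=> cv; apply: prodr_ge0 => e _; rewrite /coin; have /andP[v0 v1] := cv e.1.
by case: (t e) => //; rewrite subr_ge0.
Qed.

Lemma sum_coins_prod (f : 'I_d * 'I_N -> bool -> R) v :
  \sum_(t : {ffun 'I_d * 'I_N -> bool}) (coins t v * \prod_e f e (t e)) =
  \prod_e (v ord0 e.1 * f e true + (1 - v ord0 e.1) * f e false).
Proof.
rewrite (eq_bigr (fun e => \sum_(b : bool) coin (v ord0 e.1) b * f e b)); last first.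
  by move=> e _; rewrite big_bool.
rewrite bigA_distr_bigA; apply: eq_bigr => t _.
by rewrite /coins big_split.
Qed.

Lemma sum_coins v : \sum_(t : {ffun 'I_d * 'I_N -> bool}) coins t v = 1.
Proof.
have := sum_coins_prod (fun _ _ => 1) v.
rewrite [RHS]big1 => [<-|e _]; last by rewrite !mulr1 addrC subrK.
by apply: eq_bigr => t _; rewrite big1 ?mulr1.
Qed.

(** Distinct tosses are independent and centred, so their product averages to 0; a toss against
    itself gives the Bernoulli variance. The auxiliary [f] puts one centred factor at [e1] and one
    at [e2], hence a square when they coincide. *)
Lemma coins_covariance (e1 e2 : 'I_d * 'I_N) v :
  \sum_(t : {ffun 'I_d * 'I_N -> bool})
    coins t v * (((t e1)%:R - v ord0 e1.1) * ((t e2)%:R - v ord0 e2.1)) =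
  (e1 == e2)%:R * (v ord0 e1.1 * (1 - v ord0 e1.1)).
Proof.
pose f (e : 'I_d * 'I_N) (b : bool) : R :=
  (if e == e1 then b%:R - v ord0 e.1 else 1) *
  (if e == e2 then b%:R - v ord0 e.1 else 1).
rewrite (eq_bigr (fun t => coins t v * \prod_e f e (t e))) => [|t _]; last first.
  by rewrite /f big_split/= -!big_mkcond/= !big_pred1_eq.
rewrite sum_coins_prod /f.
have [<-|e12] := eqVneq e1 e2.
  rewrite (bigD1 e1)//= eqxx big1 => [|e ee1]; first by ring.
  by rewrite (negbTE ee1); ring.
rewrite (bigD1 e1)//= eqxx (negbTE e12) mul0r; set x := (X in X * _).
have -> : x = 0 by rewrite /x; ring.
by rewrite mul0r.
Qed.

Lemma frequency_variance i v : cube v -> (0 < N)%N ->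
  \sum_(t : {ffun 'I_d * 'I_N -> bool})
    coins t v * (frequency t ord0 i - v ord0 i) ^+ 2 <= N%:R^-1.
Proof.
move=> cv N0; have N0' : 0 < N%:R :> R by rewrite ltr0n.
have dev t : frequency t ord0 i - v ord0 i =
    N%:R^-1 * \sum_(s < N) ((t (i, s))%:R - v ord0 i).
  rewrite mxE sumrB sumr_const card_ord mulrBr; congr (_ - _).
  by rewrite -(mulr_natl (v ord0 i)) mulrA mulVf ?mul1r// gt_eqF.
have -> : \sum_(t : {ffun 'I_d * 'I_N -> bool})
    coins t v * (frequency t ord0 i - v ord0 i) ^+ 2 =
    N%:R^-1 ^+ 2 * \sum_(s < N) \sum_(s' < N)
      (((i, s) == (i, s') :> 'I_d * 'I_N)%:R * (v ord0 i * (1 - v ord0 i))).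
  under [in RHS]eq_bigr do under eq_bigr do rewrite -coins_covariance.
  under [in RHS]eq_bigr do rewrite exchange_big/=.
  rewrite exchange_big/= mulr_sumr; apply: eq_bigr => t _.
  rewrite dev exprMn mulrCA; congr (_ * _).
  rewrite expr2 mulr_suml mulr_sumr; apply: eq_bigr => s _.
  by rewrite !mulr_sumr.
rewrite (eq_bigr (fun=> v ord0 i * (1 - v ord0 i))) => [|s _]; last first.
  rewrite (bigD1 s)//= eqxx mul1r big1 ?addr0// => s' s's.
  by rewrite xpair_eqE eqxx/= eq_sym (negbTE s's) mul0r.
rewrite sumr_const card_ord -(mulr_natl (v ord0 i * _)) expr2 -mulrA.
rewrite (mulrA N%:R^-1 N%:R) mulVf ?gt_eqF// mul1r ler_piMr ?invr_ge0//.
have /andP[v0 v1] := cv i.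
nra.
Qed.

Lemma frequency_cube t : cube (frequency t).
Proof.
move=> i; rewrite mxE; have [N0|N0] := posnP N.
  by move: t; rewrite N0 => t; rewrite big_ord0 mulr0 lexx ler01.
have N0' : 0 < N%:R :> R by rewrite ltr0n.
rewrite mulr_ge0 ?invr_ge0 ?sumr_ge0//= mulrC ler_pdivrMr// mul1r.
rewrite -[X in _ <= X%:R]card_ord -sumr_const; apply: ler_sum => s _.
by rewrite lern1 leq_b1.
Qed.

(** Chebyshev's argument. Where all frequencies are within [r] of [v] the error is at most [e];
    elsewhere [D t] is at least [r ^+ 2], so the crude bound [2 * M] is at most
    [2 * M / r ^+ 2 * D t]. The mean of [D t] is at most d/N. *)
Lemma bernstein_dist (g : 'rV[R]_d -> R) (e r M : R) v : cube v -> (0 < N)%N -> 0 < r ->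
  0 <= e -> (forall u, cube u -> `|g u| <= M) ->
  (forall u u', cube u -> cube u' ->
    (forall i, `|u' ord0 i - u ord0 i| < r) -> `|g u' - g u| <= e) ->
  `|bernstein g v - g v| <= e + 2 * M * d%:R / r ^+ 2 / N%:R.
Proof.
move=> cv N0 r0 e0 gM gu.
have M0 : 0 <= M by apply: le_trans (gM v cv).
have -> : bernstein g v - g v =
    \sum_(t : {ffun 'I_d * 'I_N -> bool}) coins t v * (g (frequency t) - g v).
  rewrite -[in LHS](mul1r (g v)) -(sum_coins v) mulr_suml -sumrB.
  by apply: eq_bigr => t _; ring.
rewrite (le_trans (ler_norm_sum _ _ _))//.
pose D t := \sum_(i < d) (frequency t ord0 i - v ord0 i) ^+ 2.
have r20 : 0 < r ^+ 2 by rewrite exprn_gt0.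
have bound t : `|coins t v * (g (frequency t) - g v)| <=
    coins t v * (e + 2 * M / r ^+ 2 * D t).
  rewrite normrM ger0_norm ?coins_ge0// ler_wpM2l ?coins_ge0//.
  have D0 : 0 <= D t by apply: sumr_ge0 => i _; rewrite sqr_ge0.
  have MD0 : 0 <= 2 * M / r ^+ 2 * D t.
    by rewrite !mulr_ge0 ?invr_ge0 ?(ltW r20).
  have [/forallP close|/forallPn[i far]] :=
    boolP [forall i, `|frequency t ord0 i - v ord0 i| < r].
    by rewrite ler_wpDr//; apply: gu => //; exact: frequency_cube.
  rewrite -leNgt in far.
  apply: (@le_trans _ _ (2 * M)).
    rewrite (le_trans (ler_normB _ _))// mulr_natl mulr2n lerD// gM//.
    exact: frequency_cube.
  rewrite ler_wpDl// mulrAC ler_pdivlMr// ler_wpM2l ?mulr_ge0//.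
  rewrite /D (bigD1 i)//= ler_wpDr//.
    by apply: sumr_ge0 => j _; rewrite sqr_ge0.
  by rewrite -[leRHS]real_normK ?num_real// lerXn2r ?nnegrE// ltW.
apply: (le_trans (ler_sum _ (fun t _ => bound t))).
have -> : \sum_(t : {ffun 'I_d * 'I_N -> bool}) coins t v * (e + 2 * M / r ^+ 2 * D t) =
    e + 2 * M / r ^+ 2 * \sum_(i < d) \sum_(t : {ffun 'I_d * 'I_N -> bool})
       coins t v * (frequency t ord0 i - v ord0 i) ^+ 2.
  rewrite exchange_big/= -[in RHS](mul1r e) -(sum_coins v) mulr_suml mulr_sumr -big_split/=.
  apply: eq_bigr => t _; rewrite mulrDr -mulr_sumr.
  by rewrite -/(D t) mulrCA.
rewrite lerD2l (_ : 2 * M * d%:R / r ^+ 2 / N%:R = 2 * M / r ^+ 2 * (d%:R / N%:R)); last first.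
  by ring.
rewrite ler_wpM2l//; first by rewrite !mulr_ge0// invr_ge0 ltW.
apply: (@le_trans _ _ (\sum_(i < d) N%:R^-1)).
  by apply: ler_sum => i _; exact: frequency_variance.
by rewrite sumr_const card_ord mulr_natl.
Qed.

End bernstein.

Lemma bernstein_approximation (R : realType) (d : nat) (g : 'rV[R]_d -> R) (e : R) :
  0 < e -> {within @cube R d, continuous g} ->
  exists N0, forall N, (N0 <= N)%N -> forall v, cube v -> `|bernstein N g v - g v| <= e.
Proof.
move=> e0 cg; have e20 : 0 < e / 2 by rewrite divr_gt0.
have [M gM] := cube_bounded cg.
have [r r0 gr] := cube_uniform_continuity e20 cg.
pose K := 2 * M * d%:R / r ^+ 2.
exists (Num.truncn (`|K| / (e / 2))).+1 => N NN v cv.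
have N0 : (0 < N)%N by exact: leq_trans NN.
apply: (le_trans (bernstein_dist cv N0 r0 (ltW e20) gM gr)).
rewrite -/K [leRHS](splitr e) lerD2l ler_pdivrMr ?ltr0n//.
rewrite (le_trans (ler_norm _))// mulrC -ler_pdivrMr//.
apply/ltW; apply: (lt_le_trans (truncnS_gt _)).
by rewrite ler_nat.
Qed.

(** * Almost sure convergence of all moments *)

Section moment_convergence.
Context (R : realType) (dO : measure_display) (Omega : measurableType dO).
Variables (P : probability Omega R) (W : R -> R -> R) (X : nat -> Omega -> R).
Variable xi : nat -> nat -> Omega -> bool.
Hypotheses (hW : graphon W) (hX : iid_uniform P X) (hxi : edge_law P W X xi).
Variables (d p k : nat) (F : 'I_d -> rel 'I_p) (l : 'I_k -> 'I_p).
Hypothesis hF : forall m, simple_graph (F m).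
Hypotheses (hl : injective l) (hcomp : compatible F l).

(** Exponents are encoded as a word of coordinates with repetitions: such words form a countable
    type, multiplication by a coordinate is [cons], and each letter stands for one copy in the glued
    graph. *)
Definition monomial (s : seq 'I_d) (v : 'rV[R]_d) : R := \prod_(i <- s) v ord0 i.

Lemma words_gt0 n : (k <= n)%N -> (0 < #|words k n|)%N.
Proof.
move=> kn; apply/card_gt0P; exists [ffun i => widen_ord kn i]; rewrite inE.
by apply/injectiveP => i j; rewrite !ffunE => /(congr1 val)/= /val_inj.
Qed.

Lemma cube_intM1 : cube_int (fun x => that_x W F l x * 1) = that W F l.
Proof. by congr cube_int; apply/funext => x; rewrite mulr1. Qed.

Lemma cvg_moment (s : seq 'I_d) :
  {ae P, forall w, Gamma_n n F l (fun i j => xi i j w) (monomial s) @[n --> \oo]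
     --> Gamma W F l (monomial s)}.
Proof.
case: s => [|i0 s0].
  apply: aeW => w.
  have -> : Gamma W F l (monomial [::]) = 1.
    rewrite /Gamma (_ : (fun x => _) = (fun x => that_x W F l x * 1)); last first.
      by apply/funext => x; rewrite /monomial big_nil.
    by rewrite cube_intM1 /monomial big_nil mulr1 addrC subrK.
  (* For [n < k] there are no words and [Gamma_n] is 0, so the total mass is 1 only from [k] on. *)
  apply: cvg_near_cst; exists k => // n kn.
  rewrite /Gamma_n -[RHS](avg_cst 1 (words_gt0 kn)).
  by apply: eq_avg => a _; rewrite /monomial big_nil.
(* Indexing by a successor provides the copy 0 that carries the labelled edges. *)
pose m : 'I_(size s0).+1 -> 'I_d := tnth (in_tuple (i0 :: s0)).
have monoE : monomial (i0 :: s0) = (fun v => \prod_s v ord0 (m s)).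
  by apply/funext => v; rewrite /monomial (big_tnth _ _ (i0 :: s0)).
have GammaE : Gamma W F l (monomial (i0 :: s0)) = glued_density W F l m.
  rewrite monoE /Gamma big_ord_recl mxE mul0r mulr0 addr0 /glued_density.
  congr cube_int; apply/funext => x; congr (_ * _).
  by apply: eq_bigr => i _; rewrite mxE.
rewrite GammaE.
have := hom_density_cvg hW hX hxi (@glued_loopless d p k _ F l m)
  (glued_simple hcomp (m := m)) (cint_glued_weight hW F hl m).
apply: filterS => w hw.
have xi_sym i j : xi i j w = xi j i w by case: hxi => _ /(_ i j w).
pose K : R := ((size s0).+1 * p ^ 2 + k ^ 2)%:R.
have err : K / n%:R @[n --> \oo] --> (0 : R).
  rewrite -[X in _ --> X](mulr0 K); apply: cvgM; first exact: cvg_cst.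
  rewrite -(cvg_shiftS (fun n => n%:R^-1 : R)).
  exact: (@cvg_harmonic R).
apply/cvgrPdist_le => e e0; have e20 : 0 < e / 2 by rewrite divr_gt0.
move/cvgrPdist_le : hw => /(_ _ e20) hw; move/cvgrPdist_le : err => /(_ _ e20) err.
near=> n.
have n0 : (0 < n)%N by near: n; exact: nbhs_infty_gt.
rewrite monoE distrC.
have := Gamma_n_moment R F hl m (fun i j => xi i j w) n0.
have -> : avg [set: {ffun glued p k (size s0).+1 -> 'I_n}]
    (fun t => (glued_hom F l m (fun i j => xi i j w) t)%:R) =
    hom_density R xi (glued_edges F l m) (src l) (tgt l) n w.
  by apply: eq_avg => t _; rewrite (edges_in_glued R hF hl hcomp m).
rewrite -/K => b1.
have b2 : `|glued_density W F l m -
    hom_density R xi (glued_edges F l m) (src l) (tgt l) n w| <= e / 2.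
  by near: n.
have b3 : K / n%:R <= e / 2.
  rewrite (le_trans (ler_norm _))// -normrN -sub0r.
  by near: n.
set h := hom_density R xi _ _ _ n w in b1 b2.
by rewrite (le_trans (ler_distD h _ _))// (splitr e) lerD// ?(le_trans b1)// distrC.
Unshelve. all: by end_near. Qed.

(** The enumeration [unpickle] of the countable type [seq 'I_d] merges the exceptional sets of all
    monomials into a single null set. *)
Lemma cvg_moments :
  {ae P, forall w, forall s : seq 'I_d,
     Gamma_n n F l (fun i j => xi i j w) (monomial s) @[n --> \oo]
     --> Gamma W F l (monomial s)}.
Proof.
have h n : {ae P, forall w, forall s : seq 'I_d, unpickle n = Some s ->
     Gamma_n n F l (fun i j => xi i j w) (monomial s) @[n --> \oo]
     --> Gamma W F l (monomial s)}.
  case: (unpickle n) => [s|]; last exact: aeW.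
  by apply: filterS (cvg_moment s) => w hw _ [<-].
apply: filterS (ae_foralln h) => w hw s.
by apply: (hw (pickle s)); rewrite pickleK.
Qed.

End moment_convergence.

(** * From moments to continuous functions *)

Section method_of_moments.
Variables (R : realType) (d p k : nat) (W : R -> R -> R).
Hypothesis hW : graphon W.
Variables (F : 'I_d -> rel 'I_p) (l : 'I_k -> 'I_p) (G : rel nat).

Lemma that_x_bounds (x : 'I_k -> R) : 0 <= that_x W F l x <= 1.
Proof.
have [_ _ W01] := hW.
rewrite prodr_ge0 ?prodr_ile1// => i _.
  by apply/andP; split; [apply: prodr_ge0|apply: prodr_ile1] => j _;
    have /andP[] := W01 (lab l x i) (lab l x j); do ?move=> ->.
by apply: prodr_ge0 => j _; case/andP: (W01 (lab l x i) (lab l x j)).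
Qed.

Lemma ttilde_cube (x : 'I_k -> R) : cube (ttilde_v W F l x).
Proof.
have [_ _ W01] := hW.
move=> m; rewrite mxE ttilde_xE; have cr := cmeas_rest hW F l m.
have r01 (z : 'I_p -> R) : 0 <= rest_weight W F l m z <= 1.
  rewrite prodr_ge0 ?prodr_ile1// => i _.
    by apply/andP; split; [apply: prodr_ge0|apply: prodr_ile1] => j _;
      have /andP[] := W01 (z i) (z j); do ?move=> ->.
  by apply: prodr_ge0 => j _; case/andP: (W01 (z i) (z j)).
apply/andP; split.
  rewrite -[leLHS](cint_cst (unlabelled l) 0 (lab l x)); apply: le_cint => // [|z].
    exact: bmeas_cst.
  by case/andP: (r01 z).
rewrite -[leRHS](cint_cst (unlabelled l) 1 (lab l x)); apply: le_cint => // [|z].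
  exact: bmeas_cst.
by case/andP: (r01 z).
Qed.

Lemma tinjv_cube n (a : 'I_k -> 'I_n) : cube (tinjv R F l G a).
Proof. by move=> m; rewrite mxE; exact: tinj_bounds. Qed.

(** Apart from its value at 0, [q] enters [Gamma] only through [ttilde_v], so measurability is asked
    of this composite and no sigma-algebra on row vectors appears. *)
Definition testable (q : 'rV[R]_d -> R) := cmeas (fun x => q (ttilde_v W F l x)).

Lemma testable_coord i : testable (fun v : 'rV[R]_d => v ord0 i).
Proof. by apply: (eq_bmeas _ (cmeas_ttilde hW F l i)) => x; rewrite mxE. Qed.

Lemma testable_monomial s : testable (monomial s).
Proof. by apply: bmeas_prod => i _; exact: testable_coord. Qed.

Lemma Gamma_nD n (q1 q2 : 'rV[R]_d -> R) :
  Gamma_n n F l G (fun v : 'rV[R]_d => q1 v + q2 v) = Gamma_n n F l G q1 + Gamma_n n F l G q2.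
Proof. by rewrite /Gamma_n big_split/= mulrDr. Qed.

Lemma Gamma_nZ n c (q : 'rV[R]_d -> R) :
  Gamma_n n F l G (fun v : 'rV[R]_d => c * q v) = c * Gamma_n n F l G q.
Proof. by rewrite /Gamma_n -mulr_sumr mulrCA. Qed.

Lemma GammaD (q1 q2 : 'rV[R]_d -> R) : testable q1 -> testable q2 ->
  Gamma W F l (fun v : 'rV[R]_d => q1 v + q2 v) = Gamma W F l q1 + Gamma W F l q2.
Proof.
move=> t1 t2; have ct := cmeas_that hW F l.
rewrite /Gamma; under [X in cube_int X]eq_fun do rewrite mulrDr.
rewrite /cube_int cintD; [ring|exact: bmeasM|exact: bmeasM].
Qed.

Lemma GammaZ c (q : 'rV[R]_d -> R) : testable q ->
  Gamma W F l (fun v : 'rV[R]_d => c * q v) = c * Gamma W F l q.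
Proof.
move=> t; have ct := cmeas_that hW F l.
rewrite /Gamma; under [X in cube_int X]eq_fun do rewrite mulrCA.
by rewrite /cube_int cintZ; [ring|exact: bmeasM].
Qed.

(** [Gamma] integrates against a probability carried by the cube: mass [that] distributed through
    [ttilde_v], and mass [1 - that] at 0. *)
Lemma Gamma_dist (q1 q2 : 'rV[R]_d -> R) e : 0 <= e -> testable q1 -> testable q2 ->
  (forall v, cube v -> `|q1 v - q2 v| <= e) ->
  `|Gamma W F l q1 - Gamma W F l q2| <= e.
Proof.
move=> e0 t1 t2 q12; have ct := cmeas_that hW F l.
have th0 : 0 <= that W F l.
  rewrite -[leLHS](cint_cst (enum 'I_k) 0 (fun=> 0)); apply: le_cint => // [|z].
    exact: bmeas_cst.
  by case/andP: (that_x_bounds z).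
have th1 : that W F l <= 1.
  rewrite -[leRHS](cint_cst (enum 'I_k) 1 (fun=> 0)); apply: le_cint => // [|z].
    exact: bmeas_cst.
  by case/andP: (that_x_bounds z).
have half (f h : 'rV[R]_d -> R) : testable f -> testable h ->
    (forall v, cube v -> `|f v - h v| <= e) ->
    cube_int (fun x => that_x W F l x * f (ttilde_v W F l x)) <=
    cube_int (fun x => that_x W F l x * h (ttilde_v W F l x)) + e * that W F l.
  move=> tf th fh; rewrite /that /cube_int -cintZ// -cintD; [|exact: bmeasM|exact: bmeasZ].
  apply: le_cint => [||x]; first exact: bmeasM.
    by apply: bmeasD; [exact: bmeasM|exact: bmeasZ].
  have /andP[a0 a1] := that_x_bounds x.
  have := fh _ (ttilde_cube x); rewrite ler_norml => /andP[_ b].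
  rewrite [e * _]mulrC -mulrDr ler_wpM2l//.
  by move: b; rewrite lerBlDr addrC.
have h1 := half q1 q2 t1 t2 q12.
have h2 : cube_int (fun x => that_x W F l x * q2 (ttilde_v W F l x)) <=
    cube_int (fun x => that_x W F l x * q1 (ttilde_v W F l x)) + e * that W F l.
  by apply: half => // v cv; rewrite distrC; exact: q12.
have c0 : cube (0 : 'rV[R]_d) by move=> i; rewrite mxE lexx ler01.
have := q12 _ c0; rewrite /Gamma !ler_norml => /andP[z1 z2].
move: (cube_int _) (cube_int _) h1 h2 => A B h1 h2.
(* The atom at 0 errs by at most [e] times its weight [1 - that]; added to the error [e * that] of
   the integral part, this makes exactly [e]. *)
have y1 : 0 <= (1 - that W F l) * (q1 0 - q2 0 + e) by rewrite mulr_ge0//; lra.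
have y2 : 0 <= (1 - that W F l) * (e - (q1 0 - q2 0)) by rewrite mulr_ge0//; lra.
by apply/andP; split; lra.
Qed.

Hypothesis cvg_mono : forall s,
  Gamma_n n F l G (monomial s) @[n --> \oo] --> Gamma W F l (monomial s).

(** The arbitrary monomial factor makes the property stable under multiplication by a coordinate, as
    the induction over [coins] requires; convergence for [q] itself is the case of the empty
    monomial. *)
Definition moment_cvg (q : 'rV[R]_d -> R) := testable q /\ forall s,
  Gamma_n n F l G (fun v : 'rV[R]_d => q v * monomial s v) @[n --> \oo] -->
  Gamma W F l (fun v : 'rV[R]_d => q v * monomial s v).

Lemma moment_cvg1 : moment_cvg (fun=> 1).
Proof.
split=> [|s]; first exact: bmeas_cst.
have -> : (fun v : 'rV[R]_d => 1 * monomial s v) = monomial s.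
  by apply/funext => v; rewrite mul1r.
exact: cvg_mono.
Qed.

Lemma moment_cvgD q1 q2 : moment_cvg q1 -> moment_cvg q2 ->
  moment_cvg (fun v : 'rV[R]_d => q1 v + q2 v).
Proof.
move=> [t1 c1] [t2 c2]; split=> [|s]; first exact: bmeasD.
have -> : (fun v : 'rV[R]_d => (q1 v + q2 v) * monomial s v) =
    (fun v : 'rV[R]_d => q1 v * monomial s v + q2 v * monomial s v).
  by apply/funext => v; rewrite mulrDl.
have tm := testable_monomial s.
rewrite GammaD; [|exact: (bmeasM t1 tm)|exact: (bmeasM t2 tm)].
rewrite (_ : (fun n => _) = (fun n =>
  Gamma_n n F l G (fun v : 'rV[R]_d => q1 v * monomial s v) +
  Gamma_n n F l G (fun v : 'rV[R]_d => q2 v * monomial s v))); last first.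
  by apply/funext => n; rewrite Gamma_nD.
exact: cvgD.
Qed.

Lemma moment_cvgZ c q : moment_cvg q -> moment_cvg (fun v : 'rV[R]_d => c * q v).
Proof.
move=> [t h]; split=> [|s]; first exact: bmeasZ.
have -> : (fun v : 'rV[R]_d => c * q v * monomial s v) =
    (fun v : 'rV[R]_d => c * (q v * monomial s v)).
  by apply/funext => v; rewrite mulrA.
rewrite GammaZ; last exact: (bmeasM t (testable_monomial s)).
rewrite (_ : (fun n => _) = (fun n =>
  c * Gamma_n n F l G (fun v : 'rV[R]_d => q v * monomial s v))).
  by apply: cvgM; [exact: cvg_cst|exact: h].
by apply/funext => n; rewrite Gamma_nZ.
Qed.

Lemma moment_cvg_coord i q : moment_cvg q -> moment_cvg (fun v : 'rV[R]_d => v ord0 i * q v).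
Proof.
move=> [t h]; split=> [|s]; first exact: (bmeasM (testable_coord i) t).
have -> : (fun v : 'rV[R]_d => v ord0 i * q v * monomial s v) =
    (fun v : 'rV[R]_d => q v * monomial (i :: s) v).
  by apply/funext => v; rewrite /monomial big_cons; ring.
exact: h.
Qed.

Lemma moment_cvg_coins N (t : {ffun 'I_d * 'I_N -> bool}) : moment_cvg (coins t).
Proof.
rewrite /coins; elim: (index_enum _) => [|e r IH].
  have -> : (fun v : 'rV[R]_d => \prod_(e <- [::]) coin (v ord0 e.1) (t e)) = (fun=> 1).
    by apply/funext => v; rewrite big_nil.
  exact: moment_cvg1.
set q := (fun v : 'rV[R]_d => \prod_(e <- r) coin (v ord0 e.1) (t e)) in IH.
have -> : (fun v : 'rV[R]_d => \prod_(e <- (e :: r)) coin (v ord0 e.1) (t e)) =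
    (fun v : 'rV[R]_d => coin (v ord0 e.1) (t e) * q v).
  by apply/funext => v; rewrite big_cons.
rewrite /coin; case: (t e); first exact: moment_cvg_coord.
have -> : (fun v : 'rV[R]_d => (1 - v ord0 e.1) * q v) =
    (fun v : 'rV[R]_d => q v + (-1) * (v ord0 e.1 * q v)).
  by apply/funext => v; ring.
by apply: moment_cvgD => //; apply: moment_cvgZ; exact: moment_cvg_coord.
Qed.

Lemma moment_cvg_bernstein N g : moment_cvg (bernstein N g).
Proof.
rewrite /bernstein; elim: (index_enum _) => [|t r IH].
  have := moment_cvgZ 0 moment_cvg1.
  by congr moment_cvg; apply/funext => v; rewrite big_nil mul0r.
have -> : (fun v : 'rV[R]_d => \sum_(t <- (t :: r)) g (frequency R t) * coins t v) =
    (fun v : 'rV[R]_d => g (frequency R t) * coins t v +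
              \sum_(t <- r) g (frequency R t) * coins t v).
  by apply/funext => v; rewrite big_cons.
apply: moment_cvgD => //; apply: moment_cvgZ; exact: moment_cvg_coins.
Qed.

(** Along [ttilde_v], which stays in the cube, [g] is the pointwise limit of its Bernstein
    polynomials, and these are testable by their construction from coordinates. *)
Lemma testable_continuous g : {within @cube R d, continuous g} -> testable g.
Proof.
move=> cg; split.
  apply: (@measurable_fun_cvg _ (coords R 'I_k) _ setT
    (fun N x => bernstein N g (ttilde_v W F l x))) => [N|x _].
    by case: (moment_cvg_bernstein N g) => -[].
  apply/cvgrPdist_le => e e0; have [N0 hN] := bernstein_approximation e0 cg.
  exists N0 => // N /= NN; rewrite distrC; apply: hN => //; exact: ttilde_cube.
have [M gM] := cube_bounded cg.
by exists M => x; apply: gM; exact: ttilde_cube.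
Qed.

Lemma cvg_Gamma g : {within @cube R d, continuous g} ->
  Gamma_n n F l G g @[n --> \oo] --> Gamma W F l g.
Proof.
move=> cg; have tg := testable_continuous cg.
apply/cvgrPdist_le => e e0; have e30 : 0 < e / 3 by rewrite divr_gt0.
have [N /(_ N (leqnn N)) gN] := bernstein_approximation e30 cg.
have [tB hB] := moment_cvg_bernstein N g.
have Bc : Gamma_n n F l G (bernstein N g) @[n --> \oo] --> Gamma W F l (bernstein N g).
  have := hB [::].
  by have -> : (fun v : 'rV[R]_d => bernstein N g v * monomial [::] v) = bernstein N g
    by apply/funext => v; rewrite /monomial big_nil mulr1.
move/cvgrPdist_le : Bc => /(_ _ e30); apply: filterS => n hn.
have h1 : `|Gamma W F l g - Gamma W F l (bernstein N g)| <= e / 3.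
  by rewrite distrC; apply: Gamma_dist => //; exact: ltW.
have h2 : `|Gamma_n n F l G (bernstein N g) - Gamma_n n F l G g| <= e / 3.
  rewrite (_ : Gamma_n n F l G (bernstein N g) =
    avg (words k n) (fun a => bernstein N g (tinjv R F l G a)))//.
  apply: avg_dist => [|a _]; first exact: ltW.
  by apply: gN; exact: tinjv_cube.
move: h1 h2 hn; rewrite !ler_norml => /andP[? ?] /andP[? ?] /andP[? ?].
by apply/andP; split; lra.
Qed.

End method_of_moments.

Unset Implicit Arguments.

Theorem theorem3p3 (R : realType) (dO : measure_display) (Omega : measurableType dO)
  (P : probability Omega R) (W : R -> R -> R) (X : nat -> Omega -> R)
  (xi : nat -> nat -> Omega -> bool)
  (hW : graphon W) (hX : iid_uniform P X) (hxi : edge_law P W X xi)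
  (d p k : nat) (hd : (0 < d)%N) (hp : (0 < p)%N)
  (F : 'I_d -> rel 'I_p) (hF : forall m, simple_graph (F m))
  (l : 'I_k -> 'I_p) (hk : (0 < k)%N) (hl : injective l)
  (hcomp : compatible F l) :
  {ae P, forall w : Omega,
     forall g : 'rV[R]_d -> R, {within @cube R d, continuous g} ->
       (fun n => Gamma_n n F l (fun i j => xi i j w) g) @ \oo
         --> Gamma W F l g}.
Proof.
(* The null set comes from the moments and is fixed before [g] is introduced, so one event serves
   all test functions. *)
apply: filterS (cvg_moments hW hX hxi hF hl hcomp) => w hw g cg.
exact: (cvg_Gamma hW hw cg).
Qed.
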